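(* Let $F,f,h_1,\dots,h_p\colon\mathbb R^n\times\mathbb R^m\to\mathbb R$ be continuously differentiable, $X\subset\mathbb R^n$ closed, $I=\{1,\dots,\ell\}$, $J=\{\ell+1,\dots,p\}$, $\Gamma(x):=\{y\mid h_i(x,y)\le0\ (i\in I),\ h_i(x,y)=0\ (i\in J)\}$, $\varphi(x):=\inf\{f(x,y)\mid y\in\Gamma(x)\}$, $S(x):=\operatorname{argmin}\{f(x,y)\mid y\in\Gamma(x)\}$, $h_0(x,y):=f(x,y)-\varphi(x)$. Let $(\bar x,\bar y)$ be a local minimizer of the problem $\min_{x,y}\{F(x,y)\mid x\in X,\ y\in S(x)\}$ (BPP'). Assume one of the following: (a) (A1'): for each $x$, $f(x,\cdot)$ and $h_i(x,\cdot)$, $i\in I$, are convex and $h_i(x,\cdot)$, $i\in J$, are affine; (A2): $\Gamma$ is locally bounded at $\bar x$; and RCPLD$_S$ with respect to $\operatorname{dom}\Gamma$ holds at each point of $\{\bar x\}\times S(\bar x)$; (b) $S$ is inner semicontinuous at $(\bar x,\bar y)$ with respect to $\operatorname{dom}\Gamma$ and RCPLD$_S$ with respect to $\operatorname{dom}\Gamma$ holds at $(\bar x,\bar y)$. Then (BPP') is partially calm at $(\bar x,\bar y)$.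
   Context: $\operatorname{dom}\Gamma:=\{x\mid\Gamma(x)\neq\emptyset\}$; $\inf\emptyset=+\infty$. (BPP') is partially calm at its local minimizer $(\bar x,\bar y)$ if there exist a neighborhood $U$ of $(\bar x,\bar y,0)$ and $\kappa>0$ such that $F(x,y)-F(\bar x,\bar y)+\kappa|u|\ge0$ for all $(x,y,u)\in U$ with $x\in X$, $f(x,y)-\varphi(x)\le u$, $y\in\Gamma(x)$. $\Gamma$ is locally bounded at $\bar x$ if there are a bounded $B$ and a neighborhood $V$ of $\bar x$ with $\Gamma(x)\subset B$ for $x\in V$. $S$ is inner semicontinuous at $(\bar x,\bar y)$ with respect to $\Omega$ if for every $\{x^k\}\subset\Omega$, $x^k\to\bar x$, there is $y^k\to\bar y$ with $y^k\in S(x^k)$ for large $k$. A pair of finite families $((a^i)_{i\in I_1},(b^i)_{i\in I_2})$ is positive-linearly dependent if there are $\alpha_i\ge0$, $\beta_i$, not all zero, with $\sum\alpha_ia^i+\sum\beta_ib^i=0$. For $(\hat x,\hat y)\in\operatorname{gph}S$ let $I(\hat x,\hat y):=\{i\in I\mid h_i(\hat x,\hat y)=0\}$ and $\nabla_yh_0:=\nabla_yf$. RCPLD$_S$ holds at $(\hat x,\hat y)$ with respect to $\Omega$ if there are a neighborhood $U$ of $(\hat x,\hat y)$ and $\mathcal S\subset J$ such that: (i) $\{\nabla_yh_i(\hat x,\hat y)\mid i\in\mathcal S\}$ is a basis of the span of $\{\nabla_yh_i(\hat x,\hat y)\mid i\in J\}$; (ii) $(\nabla_yh_i(x,y))_{i\in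 J}$ has constant rank on $U\cap(\Omega\times\mathbb R^m)$; (iii) for each $K\subset\{0\}\cup I(\hat x,\hat y)$ with $((\nabla_yh_i(\hat x,\hat y))_{i\in K},(\nabla_yh_i(\hat x,\hat y))_{i\in\mathcal S})$ positive-linearly dependent, $(\nabla_yh_i(x,y))_{i\in K\cup\mathcal S}$ is linearly dependent for each $(x,y)\in U\cap(\Omega\times\mathbb R^m)$. *)

(* Defs.v *)
From HB Require Import structures.
From mathcomp Require Import all_boot all_order all_algebra.
From mathcomp Require Import all_classical all_reals all_analysis.
Set Implicit Arguments. Unset Strict Implicit. Unset Printing Implicit Defensive.
Import Order.TTheory GRing.Theory Num.Theory.
Import numFieldNormedType.Exports.
Local Open Scope classical_set_scope.
Local Open Scope ring_scope.

Section Defs.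
Variables (R : realType) (n m : nat).
Notation Rn := 'rV[R]_n.
Notation Rm := 'rV[R]_m.

Definition C1 (k : Rn -> Rm -> R) : Prop :=
  (forall p : Rn * Rm, differentiable (fun q : Rn * Rm => k q.1 q.2) p) /\
  (forall v : Rn * Rm,
      continuous (fun p : Rn * Rm => 'd (fun q : Rn * Rm => k q.1 q.2) p v)).

Definition grad_y (k : Rn -> Rm -> R) (x : Rn) (y : Rm) : Rm :=
  \row_(j < m) 'd (k x) y (delta_mx 0 j).

Variables (p l : nat).
(* index sets: indices are 0..p; index 0 stands for h_0 *)
Definition Iset : {set 'I_p.+1} := [set i : 'I_p.+1 | (0 < i <= l)%N].
Definition Jset : {set 'I_p.+1} := [set i : 'I_p.+1 | (l < i)%N].

Variables (f : Rn -> Rm -> R) (h : nat -> Rn -> Rm -> R).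

Definition Gamma (x : Rn) : set Rm :=
  [set y | (forall i : 'I_p.+1, i \in Iset -> h i x y <= 0) /\
           (forall i : 'I_p.+1, i \in Jset -> h i x y = 0)].

Definition domGamma : set Rn := [set x | Gamma x != set0].

(* value function, inf over the empty set is +oo *)
Definition phi (x : Rn) : \bar R :=
  ereal_inf [set (f x y)%:E | y in Gamma x].

Definition Ssol (x : Rn) : set Rm :=
  [set y | Gamma x y /\ (forall z, Gamma x z -> f x y <= f x z)].

(* gradient family: nabla_y h_0 := nabla_y f, nabla_y h_i for i >= 1 *)
Definition gfam (x : Rn) (y : Rm) (i : 'I_p.+1) : Rm :=
  if val i == 0%N then grad_y f x y else grad_y (h i) x y.

Definition Iact (x : Rn) (y : Rm) : {set 'I_p.+1} :=
  [set i in Iset | h i x y == 0].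

Definition pos_lin_dep (K T : {set 'I_p.+1}) (a b : 'I_p.+1 -> Rm) : Prop :=
  exists (alpha beta : 'I_p.+1 -> R),
    (forall i, i \in K -> 0 <= alpha i) /\
    ((exists2 i, i \in K & alpha i != 0) \/ (exists2 i, i \in T & beta i != 0)) /\
    \sum_(i in K) alpha i *: a i + \sum_(i in T) beta i *: b i = 0.

Definition lin_dep (K : {set 'I_p.+1}) (v : 'I_p.+1 -> Rm) : Prop :=
  exists c : 'I_p.+1 -> R,
    (exists2 i, i \in K & c i != 0) /\ \sum_(i in K) c i *: v i = 0.

Definition lin_indep (K : {set 'I_p.+1}) (v : 'I_p.+1 -> Rm) : Prop :=
  ~ lin_dep K v.

Definition span_of (K : {set 'I_p.+1}) (v : 'I_p.+1 -> Rm) (w : Rm) : Prop :=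
  exists c : 'I_p.+1 -> R, w = \sum_(i in K) c i *: v i.

Definition is_basis_of_span (T K : {set 'I_p.+1}) (v : 'I_p.+1 -> Rm) : Prop :=
  lin_indep T v /\ (forall i, i \in T -> span_of K v (v i)) /\
  (forall j, j \in K -> span_of T v (v j)).

Definition fam_rank (K : {set 'I_p.+1}) (v : 'I_p.+1 -> Rm) : nat :=
  \rank (\matrix_(i < p.+1, j < m) (if i \in K then v i 0 j else 0)).

Definition RCPLD_S (Omega : set Rn) (xh : Rn) (yh : Rm) : Prop :=
  exists (U : set (Rn * Rm)) (T : {set 'I_p.+1}),
    nbhs (xh, yh) U /\ T \subset Jset /\
    is_basis_of_span T Jset (gfam xh yh) /\
    (exists r : nat, forall x y, U (x, y) -> Omega x ->
        fam_rank Jset (gfam x y) = r) /\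
    (forall K : {set 'I_p.+1}, K \subset (ord0 |: Iact xh yh) ->
       pos_lin_dep K T (gfam xh yh) (gfam xh yh) ->
       forall x y, U (x, y) -> Omega x -> lin_dep (K :|: T) (gfam x y)).

Definition A1' : Prop :=
  forall x : Rn,
    (forall (y z : Rm) (t : R), 0 <= t <= 1 ->
       f x (t *: y + (1 - t) *: z) <= t * f x y + (1 - t) * f x z) /\
    (forall i : 'I_p.+1, i \in Iset -> forall (y z : Rm) (t : R), 0 <= t <= 1 ->
       h i x (t *: y + (1 - t) *: z) <= t * h i x y + (1 - t) * h i x z) /\
    (forall i : 'I_p.+1, i \in Jset -> forall (y z : Rm) (t : R),
       h i x (t *: y + (1 - t) *: z) = t * h i x y + (1 - t) * h i x z).

Definition loc_bounded_Gamma (xb : Rn) : Prop :=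
  exists (B : set Rm) (M : R), (forall y, B y -> `|y| <= M) /\
    exists V : set Rn, nbhs xb V /\ (forall x, V x -> Gamma x `<=` B).

Definition inner_semicont_S (Omega : set Rn) (xb : Rn) (yb : Rm) : Prop :=
  forall xk : nat -> Rn, (forall k, Omega (xk k)) -> xk @ \oo --> xb ->
    exists yk : nat -> Rm, yk @ \oo --> yb /\
      (\forall k \near \oo, Ssol (xk k) (yk k)).

Definition local_min_BPP (F : Rn -> Rm -> R) (X : set Rn) (xb : Rn) (yb : Rm) : Prop :=
  X xb /\ Ssol xb yb /\
  exists V : set (Rn * Rm), nbhs (xb, yb) V /\
    forall x y, V (x, y) -> X x -> Ssol x y -> F xb yb <= F x y.

Definition partially_calm (F : Rn -> Rm -> R) (X : set Rn) (xb : Rn) (yb : Rm) : Prop :=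
  exists (U : set ((Rn * Rm) * R)) (kappa : R), nbhs ((xb, yb), 0) U /\ 0 < kappa /\
    forall x y u, U ((x, y), u) -> X x -> ((f x y)%:E - phi x <= u%:E)%E ->
      Gamma x y -> 0 <= F x y - F xb yb + kappa * `|u|.

End Defs.

(* Main.v *)
(* Write h_0 = f - phi.  The heart of the matter is the error bound
   dist(y, S(x)) <= kappa h_0(x, y) for feasible (x, y) near (xb, yb); partial
   calmness follows from it because F is locally Lipschitz.

   For fixed x, let P be the sum of the squared violations of the system
   h_0 <= 0, h_i <= 0 (i in I), h_j = 0 (j in J) describing S(x), and let w
   minimize |w - y|^2 + N P(w) near y.  Stationarity writes y - w as a
   combination of the gradients at w with nonnegative coefficients on the
   violated inequalities.  RCPLD_S and Caratheodory's reduction turn it into a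
   combination over K :|: T for which the gradients at the base point are not
   positive-linearly dependent, so its coefficients are at most C |y - w| with
   C independent of x, y and N.  Taking the inner product with y - w and using
   strict differentiability yields |y - w| <= kappa h_0(x, y).  As N tends to
   infinity the minimizers accumulate at a zero of P, i.e. at a point of S(x):
   either because S(x) has a point close to y (inner semicontinuity), or because
   P is convex.  In the convex case S(x) may a priori be far from y, and lower
   semicontinuity of phi, from local boundedness of Gamma, keeps w well inside
   the ball over which it minimizes. *)
Require Import Defs.
From HB Require Import structures.
From mathcomp Require Import all_boot all_order all_algebra.
From mathcomp Require Import all_classical all_reals all_analysis.
From mathcomp Require Import ring lra.
Import Order.TTheory GRing.Theory Num.Theory.
Import numFieldNormedType.Exports.
Local Open Scope classical_set_scope.
Local Open Scope ring_scope.
Set Implicit Arguments.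
Unset Strict Implicit.

Lemma continuous_sum (R : realType) (V : normedModType R) (T : topologicalType)
  (I : finType) (F : I -> T -> V) :
  (forall i, continuous (F i)) -> continuous (fun x => \sum_i F i x).
Proof. by move=> cF; apply: continuous_big => //; exact: add_continuous. Qed.

(** * Inner product and maximum norm on row vectors *)

Section Dot.
Variables (R : realType) (m : nat).
Implicit Types u v w : 'rV[R]_m.

(** Row vectors carry the maximum norm, whereas the argument is Euclidean; this inner product
    supplies the Euclidean side, and the two are compared at the cost of a factor [m]. *)
Definition dot u v : R := \sum_j u 0 j * v 0 j.

Lemma dotC u v : dot u v = dot v u.
Proof. by apply: eq_bigr => j _; rewrite mulrC. Qed.

Lemma dotDr u v w : dot u (v + w) = dot u v + dot u w.
Proof. by rewrite -big_split; apply: eq_bigr => j _; rewrite mxE mulrDr. Qed.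

Lemma dotZr a u v : dot u (a *: v) = a * dot u v.
Proof. by rewrite mulr_sumr; apply: eq_bigr => j _; rewrite mxE mulrCA. Qed.

Lemma dotNr u v : dot u (- v) = - dot u v.
Proof. by rewrite -scaleN1r dotZr mulN1r. Qed.

Lemma dotBr u v w : dot u (v - w) = dot u v - dot u w.
Proof. by rewrite dotDr dotNr. Qed.

Lemma dotDl u v w : dot (u + v) w = dot u w + dot v w.
Proof. by rewrite dotC dotDr !(dotC w). Qed.

Lemma dotZl a u v : dot (a *: u) v = a * dot u v.
Proof. by rewrite dotC dotZr dotC. Qed.

Lemma dotBl u v w : dot (u - v) w = dot u w - dot v w.
Proof. by rewrite dotC dotBr !(dotC w). Qed.

Lemma dot0l v : dot 0 v = 0.
Proof. by rewrite -(scale0r 0) dotZl mul0r. Qed.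

Lemma dot_suml (I : finType) (u : I -> 'rV[R]_m) v :
  dot (\sum_i u i) v = \sum_i dot (u i) v.
Proof.
apply: (big_ind2 (fun a b => dot a v = b)) => //; first exact: dot0l.
by move=> a b c d <- <-; rewrite dotDl.
Qed.

Lemma dot_delta u j : dot u (delta_mx 0 j) = u 0 j.
Proof.
rewrite /dot (bigD1 j) //= big1 ?addr0 => [|i ij]; rewrite mxE eqxx /=.
  by rewrite eqxx mulr1.
by rewrite (negbTE ij) mulr0.
Qed.

Lemma coordB u v j : (u - v) 0 j = u 0 j - v 0 j.
Proof. by rewrite !mxE. Qed.

Lemma coord_norm u j : `|u 0 j| <= `|u|.
Proof.
by rewrite [leRHS]/Num.norm /= mx_normrE; apply/bigmax_geP; right; exists (0, j).
Qed.

Lemma norm_le_coord u e : 0 <= e -> (forall j, `|u 0 j| <= e) -> `|u| <= e.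
Proof.
move=> e0 ue; rewrite [leLHS]/Num.norm /= mx_normrE; apply/bigmax_leP; split => //.
by move=> [i j] _; rewrite ord1.
Qed.

Lemma norm_dot u v : `|dot u v| <= m%:R * (`|u| * `|v|).
Proof.
apply: le_trans (ler_norm_sum _ _ _) _.
rewrite (_ : m%:R * _ = \sum_(j < m) (`|u| * `|v|)); last first.
  by rewrite sumr_const card_ord mulr_natl.
by apply: ler_sum => j _; rewrite normrM ler_pM // coord_norm.
Qed.

Lemma dot_ge0 u : 0 <= dot u u.
Proof. by apply: sumr_ge0 => j _; rewrite -expr2 sqr_ge0. Qed.

Lemma norm_sqr_le_dot u : `|u| ^+ 2 <= dot u u.
Proof.
rewrite -(ler_sqrt _ (dot_ge0 u)) sqrtr_sqr normr_id.
apply: norm_le_coord => [|j]; first exact: sqrtr_ge0.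
rewrite -sqrtr_sqr ler_sqrt ?dot_ge0// /dot (bigD1 j) //= -expr2 lerDl.
by apply: sumr_ge0 => i _; rewrite -expr2 sqr_ge0.
Qed.

Lemma dot_le_norm_sqr u : dot u u <= m%:R * `|u| ^+ 2.
Proof. exact: le_trans (ler_norm _) (norm_dot u u). Qed.

Lemma continuous_sqdist v : continuous (fun u => dot (u - v) (u - v)).
Proof.
rewrite /dot; apply: continuous_sum => j u.
have c : {for u, continuous (fun w : 'rV[R]_m => (w - v) 0 j)}.
  have -> : (fun w : 'rV[R]_m => (w - v) 0 j) = (fun w => w 0 j) - cst (v 0 j).
    by apply: funext => w; rewrite !mxE.
  apply: differentiable_continuous; apply: differentiableB => //.
  exact: differentiable_coord.
exact: (@continuousM _ _ _ _ u c c).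
Qed.

End Dot.

(** * Partial gradients and strict differentiability *)

Section Grad.
Variables (R : realType) (n m : nat).
Implicit Types k : 'rV[R]_n -> 'rV[R]_m -> R.

Lemma diff_grad_y k x y v : 'd (k x) y v = dot (grad_y k x y) v.
Proof.
rewrite {1}[v]row_sum_delta linear_sum /dot; apply: eq_bigr => j _.
by rewrite linearZ mxE mulrC.
Qed.

Let differentiable_pairr (x : 'rV[R]_n) (y : 'rV[R]_m) :
  differentiable (fun z : 'rV[R]_m => (x, z)) y.
Proof.
apply: (@differentiable_pair _ _ _ _ (cst x) id); first exact: differentiable_cst.
by have [] := is_diff_id y.
Qed.

Lemma C1_slice k x y : C1 k -> differentiable (k x) y.
Proof.
move=> [dk _].
have -> : k x = (fun q : 'rV[R]_n * 'rV[R]_m => k q.1 q.2) \o (fun y => (x, y)).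
  by apply: funext.
by apply: differentiable_comp.
Qed.

Lemma C1_diff_slice k x y v : C1 k ->
  'd (k x) y v = 'd (fun q : 'rV[R]_n * 'rV[R]_m => k q.1 q.2) (x, y) (0, v).
Proof.
move=> [dk _].
have -> : k x = (fun q : 'rV[R]_n * 'rV[R]_m => k q.1 q.2) \o (fun y => (x, y)).
  by apply: funext.
rewrite diff_comp //= (@diff_pair _ _ _ _ (cst x) id) //=.
by rewrite diff_cst diff_val.
Qed.

Lemma C1_continuous k : C1 k ->
  continuous (fun q : 'rV[R]_n * 'rV[R]_m => k q.1 q.2).
Proof. by move=> [dk _] q; exact: differentiable_continuous. Qed.

Lemma C1_continuous_slice k x : C1 k -> continuous (k x).
Proof. by move=> k1 y; apply/differentiable_continuous/C1_slice. Qed.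

(** [C1] provides continuity of each directional derivative; the finitely many coordinate directions
    together give continuity in norm. *)
Lemma C1_grad_continuous k (q0 : 'rV[R]_n * 'rV[R]_m) (e : R) : C1 k -> 0 < e ->
  \forall q \near q0, `|grad_y k q.1 q.2 - grad_y k q0.1 q0.2| <= e.
Proof.
move=> k1 e0.
have H (j : 'I_m) : \forall q \near q0,
    `|grad_y k q.1 q.2 0 j - grad_y k q0.1 q0.2 0 j| <= e.
  have [G E cG] : exists2 G : 'rV[R]_n * 'rV[R]_m -> R,
      (forall q, grad_y k q.1 q.2 0 j = G q) & continuous G.
    exists (fun q => 'd (fun q : 'rV[R]_n * 'rV[R]_m => k q.1 q.2) q (0, delta_mx 0 j)).
      by case => a b; rewrite mxE C1_diff_slice.
    exact: (proj2 k1).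
  have := cG q0 => /cvgr_dist_le /(_ e e0).
  by apply: filterS => q; rewrite distrC -(E q) -(E q0).
have : \forall q \near q0, forall j : 'I_m,
    `|grad_y k q.1 q.2 0 j - grad_y k q0.1 q0.2 0 j| <= e.
  exact: (@filter_forall _ _ _ _ (nbhs_filter q0) H).
apply: filterS => q Hq; apply: norm_le_coord => [|j]; first exact: ltW.
by rewrite coordB.
Qed.

Lemma is_derive_line (g : 'rV[R]_m -> R) w v (t : R) :
  differentiable g (w + t *: v) ->
  is_derive t 1 (fun s : R => g (w + s *: v)) ('d g (w + t *: v) v).
Proof.
move=> dg.
have d1 : is_diff t (fun s : R => w + s *: v) (fun s => s *: v).
  have -> : (fun s : R => s *: v) = cst 0 + (fun s : R => s *: v).
    by apply: funext => s /=; rewrite -[RHS]/(0 + s *: v) add0r.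
  exact: is_diffD.
have dc : differentiable (g \o (fun s : R => w + s *: v)) t.
  by apply: differentiable_comp => //; exact: ex_diff.
apply: DeriveDef; first exact: diff_derivable dc.
rewrite -[LHS]/('D_1 (g \o (fun s : R => w + s *: v)) t) deriveE //.
rewrite diff_comp //=; by rewrite diff_val scale1r.
Qed.

(** Mean value theorem on the segment from [w] to [y], for [k x] minus its linear part [g]. The
    intermediate point stays in the ball by convexity, and there the gradient is close to [g]; one
    radius serves all [x] near [xb]. *)
Lemma C1_strict k (xb : 'rV[R]_n) (yb : 'rV[R]_m) (e : R) : C1 k -> 0 < e ->
  exists2 d : R, 0 < d & forall (x : 'rV[R]_n) (y w : 'rV[R]_m),
    `|x - xb| < d -> `|y - yb| < d -> `|w - yb| < d ->
    `|k x y - k x w - dot (grad_y k xb yb) (y - w)| <= e * `|y - w|.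
Proof.
move=> k1 e0.
(* This absorbs the factor [m] of [norm_dot]; [m.+1] avoids dividing by zero. *)
have e'0 : 0 < e / m.+1%:R by rewrite divr_gt0.
have /nbhs_ballP[d /= d0 Hd] := C1_grad_continuous (xb, yb) k1 e'0.
exists d => // x y w xd yd wd.
set g := grad_y k xb yb.
pose psi (t : R) : R := k x (w + t *: (y - w)) - t * dot g (y - w).
pose dpsi (t : R) : R := 'd (k x) (w + t *: (y - w)) (y - w) - dot g (y - w).
have dp (t : R) : is_derive t (1 : R) psi (dpsi t).
  have -> : psi = (fun s : R => k x (w + s *: (y - w))) - (dot g (y - w) \*: id).
    by apply: funext => s; rewrite /psi mulrC.
  apply: is_deriveB; first exact: is_derive_line (C1_slice _ _ k1).
  have := @is_deriveZ R R R id (dot g (y - w)) t 1 1 (is_derive_id _ _).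
  by rewrite [_ *: 1]mulr1.
have cp : {within `[0, 1], continuous psi}.
  apply: continuous_subspaceT => t; apply: differentiable_continuous.
  by apply/derivable1_diffP; have [] := dp t.
have [c c01] := @MVT R psi dpsi 0 1 ltr01 (fun t _ => dp t) cp.
have yE : w + (y - w) = y by rewrite addrC subrK.
rewrite /psi /dpsi scale1r scale0r addr0 mul1r mul0r !subr0 mulr1 yE addrAC => ->.
rewrite diff_grad_y -dotBl.
have cin : ball (xb, yb) d (x, w + c *: (y - w)).
  split => /=; rewrite -ball_normE /= distrC //.
  move: c01; rewrite in_itv /= => /andP[c0 c1].
  have -> : w + c *: (y - w) - yb = (1 - c) *: (w - yb) + c *: (y - yb).
    by apply/matrixP => i j; rewrite !mxE; ring.
  apply: le_lt_trans (ler_normD _ _) _; rewrite !normrZ !gtr0_norm ?subr_gt0//.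
  have -> : d = (1 - c) * d + c * d by ring.
  by apply: ltrD; rewrite ltr_pM2l // subr_gt0.
have := Hd _ cin => /= {}Hd.
apply: le_trans (norm_dot _ _) _.
rewrite mulrA ler_wpM2r //.
apply: le_trans (_ : m%:R * (e / m.+1%:R) <= _); first by rewrite ler_wpM2l.
by rewrite mulrCA -[leRHS]mulr1 ler_pM2l // ler_pdivrMr // mul1r ler_nat.
Qed.

(** Moves the gradient from the base point to [w]: half of [e] pays for [C1_strict], the other half
    for the variation of the gradient. *)
Lemma C1_strict_grad k (xb : 'rV[R]_n) (yb : 'rV[R]_m) (e : R) : C1 k -> 0 < e ->
  exists2 d : R, 0 < d & forall (x : 'rV[R]_n) (y w : 'rV[R]_m),
    `|x - xb| < d -> `|y - yb| < d -> `|w - yb| < d ->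
    `|k x y - k x w - dot (grad_y k x w) (y - w)| <= e * `|y - w|.
Proof.
move=> k1 e0.
have e2 : 0 < e / 2 by rewrite divr_gt0.
have e'0 : 0 < e / 2 / m.+1%:R by rewrite divr_gt0.
have [d1 d10 H1] := C1_strict xb yb k1 e2.
have /nbhs_ballP[d2 /= d20 H2] := C1_grad_continuous (xb, yb) k1 e'0.
exists (Num.min d1 d2); first by rewrite lt_min d10.
move=> x y w; rewrite !lt_min => /andP[xd1 xd2] /andP[yd1 yd2] /andP[wd1 wd2].
have := H1 x y w xd1 yd1 wd1.
have : ball (xb, yb) d2 (x, w) by split; rewrite -ball_normE /= distrC.
move=> /H2 /= {}H2 {}H1.
have -> : k x y - k x w - dot (grad_y k x w) (y - w) =
  (k x y - k x w - dot (grad_y k xb yb) (y - w)) - dot (grad_y k x w - grad_y k xb yb) (y - w).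
  by rewrite dotBl opprB addrA subrK.
apply: le_trans (ler_normB _ _) _.
rewrite (_ : e * _ = e / 2 * `|y - w| + e / 2 * `|y - w|); last by field.
apply: lerD => //; apply: le_trans (norm_dot _ _) _.
rewrite mulrA ler_wpM2r //.
apply: le_trans (_ : m%:R * (e / 2 / m.+1%:R) <= _); first by rewrite ler_wpM2l.
by rewrite mulrCA -[leRHS]mulr1 ler_pM2l // ler_pdivrMr // mul1r ler_nat.
Qed.

End Grad.

(** * Caratheodory's reduction, ranks of families and bounds on coefficients *)

Section Caratheodory.
Variables (R : realType) (m p : nat).
Implicit Types (K T J : {set 'I_p.+1}) (v w : 'I_p.+1 -> 'rV[R]_m) (c : 'I_p.+1 -> R).

Lemma sum_disjointU (V : nmodType) K T (F : 'I_p.+1 -> V) : [disjoint K & T]%B ->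
  \sum_(i in K :|: T) F i = \sum_(i in K) F i + \sum_(i in T) F i.
Proof.
by move=> dKT; rewrite -bigU //; apply: eq_bigl => i; rewrite !inE.
Qed.

(** Induction on [#|K|]: as long as [K :|: T] is dependent, subtracting a multiple of a dependence
    removes one index of [K] and keeps the signs on [K]; coefficients on [T] are free. *)
Lemma caratheodory K T v c : [disjoint K & T]%B -> lin_indep T v ->
  (forall i, i \in K -> 0 <= c i) ->
  exists K' c', [/\ K' \subset K, forall i, i \in K' -> 0 <= c' i,
    lin_indep (K' :|: T) v &
    \sum_(i in K' :|: T) c' i *: v i = \sum_(i in K :|: T) c i *: v i].
Proof.
have [N] := ubnP #|K|; elim: N => // N IH in K c * => KN dKT iT c0.
have [dep|] := pselect (lin_dep (K :|: T) v); last by exists K, c; split.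
have [e [i0 i0K ei0] e0] : exists2 e : 'I_p.+1 -> R, (exists2 i, i \in K & 0 < e i) &
    \sum_(i in K :|: T) e i *: v i = 0.
  case: dep => e [[i iKT ei] e0].
  (* A dependence supported in [T] alone would contradict the independence of [T]. *)
  have [j jK ej] : exists2 j, j \in K & e j != 0.
    apply: contrapT => nex; apply: iT; exists e; split.
      exists i => //; move: iKT; rewrite inE => /orP[iK|//].
      by exfalso; apply: nex; exists i.
    rewrite sum_disjointU // big1 ?add0r // in e0 => k kK.
    have [->|ek] := eqVneq (e k) 0; first by rewrite scale0r.
    by exfalso; apply: nex; exists k.
  have [ej0|ej0] := ltP 0 (e j); first by exists e => //; exists j.
  exists (fun i => - e i); first by exists j; rewrite // oppr_gt0 lt_neqAle ej.
  by under eq_bigr do rewrite scaleNr; rewrite sumrN e0 oppr0.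
have Pi0 : (i0 \in K) && (0 < e i0) by rewrite i0K.
(* Ratio test: the smallest quotient [c i / e i] over [e i > 0] is the largest step that keeps all
   coefficients on [K] nonnegative, and it annihilates the one at [i1]. *)
have [i1 /andP[i1K ei1] i1min] := @arg_minP _ _ _ i0
  (fun i => (i \in K) && (0 < e i)) (fun i => c i / e i) Pi0.
set t := c i1 / e i1 in i1min.
have t0 : 0 <= t by rewrite divr_ge0 ?c0 // ltW.
pose c' i := c i - t * e i.
have c'0 i : i \in K -> 0 <= c' i.
  move=> iK; rewrite /c' subr_ge0.
  have [ei|ei] := ltP 0 (e i); last by rewrite (le_trans _ (c0 _ iK)) // mulr_ge0_le0.
  by rewrite -ler_pdivlMr // i1min // iK.
have c'i1 : c' i1 = 0 by rewrite /c' /t divfK ?subrr // gt_eqF.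
have [||||K' [d [K'K d0 iK' dE]]] := IH (K :\ i1) c'.
- by move: KN; rewrite (cardsD1 i1 K) i1K.
- by apply: disjointWl dKT; exact: subsetDl.
- by [].
- by move=> i; rewrite !inE => /andP[_]; exact: c'0.
exists K', d; split => //; first exact: (fintype.subset_trans K'K (subsetDl _ _)).
rewrite dE.
have -> : \sum_(i in K :|: T) c i *: v i = \sum_(i in K :|: T) c' i *: v i.
  under [RHS]eq_bigr do rewrite scalerBl -scalerA.
  by rewrite sumrB -scaler_sumr e0 scaler0 subr0.
have i1KT : i1 \in K :|: T by rewrite inE i1K.
rewrite [RHS](bigD1 i1) //= c'i1 scale0r add0r; apply: eq_bigl => i.
have [-> /=|ii1] := eqVneq i i1; last by rewrite !inE ii1 /= andbT.
by rewrite !inE eqxx /= (disjointFr dKT i1K) ?andbF.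
Qed.

(** The matrix behind [fam_rank]: rows outside [K] vanish, so its row space is the span of the
    family over [K]. *)
Let fmx K v := \matrix_(i < p.+1, j < m) (if i \in K then v i 0 j else 0).

Let row_fmx K v i : row i (fmx K v) = if i \in K then v i else 0.
Proof. by apply/rowP => j; rewrite !mxE; case: ifP; rewrite ?mxE. Qed.

Let sub_fmx K v (u : 'rV[R]_m) : span_of K v u -> (u <= fmx K v)%MS.
Proof.
move=> [c ->]; apply: summx_sub => i iK; apply: scalemx_sub.
by have := row_sub i (fmx K v); rewrite row_fmx iK.
Qed.

Let fmx_span K v (u : 'rV[R]_m) : (u <= fmx K v)%MS -> span_of K v u.
Proof.
move=> /submxP[D ->]; exists (fun i => D 0 i).
rewrite mulmx_sum_row [RHS]big_mkcond; apply: eq_bigr => i _.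
by rewrite row_fmx; case: ifP => _; rewrite ?scaler0.
Qed.

(** Without its zero rows the matrix becomes row free, with one row per index of [T]. *)
Lemma fam_rank_lin_indep T v : lin_indep T v -> fam_rank T v = #|T|.
Proof.
move=> iT; rewrite /fam_rank -/(fmx T v).
pose B := \matrix_(i < #|T|) v (enum_val i).
have rB i : row i B = v (enum_val i) by rewrite rowK.
have fB : row_free B.
  apply: inj_row_free => u uB; apply/rowP => k; rewrite mxE.
  apply: contrapT => uk; apply: iT.
  pose c i := u 0 (enum_rank_in (enum_valP k) i).
  have cE j : c (enum_val j) = u 0 j by rewrite /c enum_valK_in.
  exists c; split; first by exists (enum_val k); [exact: enum_valP|rewrite cE; exact/eqP].
  rewrite big_enum_val /= -[RHS]uB mulmx_sum_row; apply: eq_bigr => j _.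
  by rewrite cE rB.
rewrite -(eqP fB); apply/eqP; rewrite eqn_leq; apply/andP; split; apply: mxrankS.
  apply/row_subP => i; rewrite row_fmx; case: ifP => iT'; last exact: sub0mx.
  by rewrite -(enum_rankK_in iT' iT') -rB row_sub.
by apply/row_subP => i; rewrite rB -[v _](_ : row (enum_val i) (fmx T v) = _)
  ?row_sub // row_fmx enum_valP.
Qed.

Let fmxS T J v : T \subset J -> (fmx T v <= fmx J v)%MS.
Proof.
move=> TJ; apply/row_subP => i; rewrite row_fmx; case: ifP => iT; last exact: sub0mx.
by have := row_sub i (fmx J v); rewrite row_fmx (fintype.subsetP TJ).
Qed.

Lemma fam_rank_basis T J v : T \subset J -> lin_indep T v ->
  (forall j, j \in J -> span_of T v (v j)) -> fam_rank J v = #|T|.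
Proof.
move=> TJ iT sT; rewrite -(fam_rank_lin_indep iT) /fam_rank -!/(fmx _ v).
apply/eqP; rewrite eqn_leq; apply/andP; split; apply: mxrankS; last exact: fmxS.
apply/row_subP => i; rewrite row_fmx; case: ifP => iJ; last exact: sub0mx.
exact/sub_fmx/sT.
Qed.

(** The row space over [T] lies in the one over [J] and has the same dimension, so the two
    coincide. *)
Lemma span_of_fam_rank T J v : T \subset J -> lin_indep T v -> fam_rank J v = #|T| ->
  forall j, j \in J -> span_of T v (v j).
Proof.
move=> TJ iT rJ j jJ; apply: fmx_span.
have /eqP := esym rJ; rewrite -(fam_rank_lin_indep iT) /fam_rank -!/(fmx _ v).
rewrite (mxrank_leqif_sup (fmxS v TJ)); apply: submx_trans.
by have := row_sub j (fmx J v); rewrite row_fmx jJ.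
Qed.

(* Compactness of the unit sphere of admissible coefficient vectors gives a
   bound at [v], and the bound survives small perturbations of [v]. *)
Lemma coef_bound K T v : [disjoint K & T]%B -> ~ pos_lin_dep K T v v ->
  exists C d, [/\ 0 < C, 0 < d & forall w, (forall i, `|w i - v i| <= d) ->
    forall c, (forall i, i \in K -> 0 <= c i) ->
    forall i, i \in K :|: T -> `|c i| <= C * `|\sum_(i in K :|: T) c i *: w i| ].
Proof.
move=> dKT nd.
pose A := [set c : 'rV[R]_p.+1 | `|c| = 1 /\ (forall i, i \in K -> 0 <= c 0 i)].
pose phi (w : 'I_p.+1 -> 'rV[R]_m) (c : 'rV[R]_p.+1) : R := `|\sum_i c 0 i *: w i|.
pose B := A `&` [set c : 'rV[R]_p.+1 | forall i, i \notin K :|: T -> c 0 i = 0].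
have cphi w : continuous (phi w).
  have cS : continuous (fun c : 'rV[R]_p.+1 => \sum_i c 0 i *: w i).
    apply: continuous_sum => i c.
    have ci := @coord_continuous R 1 p.+1 0 i c.
    exact: (continuous_comp ci (@scalel_continuous _ _ (w i) _)).
  move=> c; exact: (continuous_comp (cS c) (@norm_continuous _ _ _)).
have cB : compact B.
  apply: bounded_closed_compact.
    exists 1; split => // M M1 c [[c1 _] _].
    by rewrite /= c1 ltW.
  have clcoord (i : 'I_p.+1) (S : set R) : closed S -> closed [set c : 'rV[R]_p.+1 | S (c 0 i)].
    move=> cS; apply: (@closed_comp _ _ (fun c : 'rV[R]_p.+1 => c 0 i) S) => // c _.
    exact: coord_continuous.
  have -> : B = [set c : 'rV[R]_p.+1 | `|c| = 1] `&`
     (\bigcap_(i in [set i | i \in K]) [set c : 'rV[R]_p.+1 | 0 <= c 0 i] `&`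
      \bigcap_(i in [set i | i \notin K :|: T]) [set c : 'rV[R]_p.+1 | c 0 i = 0]).
    by apply/seteqP; split => c /=; [move=> [[? ?] ?]|move=> [? [? ?]]]; split.
  apply: closedI; last apply: closedI.
  - apply: (@closed_comp _ _ (fun c : 'rV[R]_p.+1 => `|c|) [set 1]); last exact: closed_eq.
    by move=> c _; exact: norm_continuous.
  - by apply: closed_bigI => i _; apply: (clcoord i [set x | 0 <= x]); exact: closed_ge.
  - by apply: closed_bigI => i _; apply: (clcoord i [set x | x = 0]); exact: closed_eq.
(* A zero of [phi v] on [B] would be a positive-linear dependence, so the minimum over the compact
   set [B] is positive; for empty [B] any [del] does. *)
have [del del0 Hdel] : exists2 del : R, 0 < del &
    forall c : 'rV[R]_p.+1, B c -> del <= phi v c.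
  have [B0|/set0P/negP/negPn/eqP B0] := pselect (B !=set0); last first.
    by exists 1 => // c; rewrite B0.
  have [|c /set_mem [[c1 cK] cN] cmin] := EVT_min_rV B0 cB (f := phi v).
    exact/continuous_subspaceT.
  exists (phi v c); last by move=> c' Bc'; apply: cmin; rewrite inE.
  rewrite lt_neqAle normr_ge0 andbT eq_sym; apply/negP => /eqP/normr0_eq0 phi0.
  apply: nd; exists (c 0), (c 0); split => //; split; last first.
    rewrite -sum_disjointU // -[RHS]phi0 [LHS]big_mkcond; apply: eq_bigr => i _.
    by case: ifPn => // /cN ->; rewrite scale0r.
  apply: contrapT => nex.
  have : c = 0.
    apply/rowP => i; rewrite mxE; apply: contrapT => /eqP ci; apply: nex.
    have [|/cN/eqP] := boolP (i \in K :|: T); last by rewrite (negbTE ci).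
    by rewrite inE => /orP[?|?]; [left|right]; exists i.
  by move=> c0; move: c1; rewrite c0 normr0 => /esym/eqP; rewrite oner_eq0.
(* The [p.+1] perturbations add up to at most [del / 2], which leaves [phi w] at least [del / 2] on
   [B]; rescaling from the unit sphere gives the factor [2 / del]. *)
exists (2 / del), (del / 2 / p.+1%:R); split; rewrite ?divr_gt0 //.
move=> w wv c c0 i iKT.
pose c' : 'rV[R]_p.+1 := \row_j (if j \in K :|: T then c j else 0).
have sE : \sum_(i in K :|: T) c i *: w i = \sum_i c' 0 i *: w i.
  rewrite big_mkcond; apply: eq_bigr => j _; rewrite mxE.
  by case: ifP; rewrite ?scale0r.
have cic' : `|c i| <= `|c'|.
  by apply: le_trans (coord_norm c' i); rewrite mxE iKT.
have [c'0|c'0] := eqVneq c' 0.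
  by rewrite (le_trans cic') // c'0 normr0 mulr_ge0 // divr_ge0 // ltW.
have a0 : 0 < `|c'| by rewrite normr_gt0.
pose b := `|c'|^-1 *: c'.
have b1 : `|b| = 1 by rewrite normrZ normfV normr_id mulVf // gt_eqF.
have Bb : B b.
  split; first split => //.
    by move=> j jK; rewrite !mxE inE jK /= mulr_ge0 // ?invr_ge0 // c0.
  by move=> j /negbTE jN; rewrite !mxE jN mulr0.
have Hb : del / 2 <= phi w b.
  have h1 : phi v b - phi w b <= \sum_i `|w i - v i|.
    apply: le_trans (lerB_dist _ _) _; rewrite -sumrB; apply: le_trans (ler_norm_sum _ _ _) _.
    apply: ler_sum => j _; rewrite -scalerBr normrZ distrC.
    by rewrite ler_piMl // -b1 coord_norm.
  have h2 : \sum_i `|w i - v i| <= del / 2.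
    apply: le_trans (_ : \sum_(i < p.+1) (del / 2 / p.+1%:R) <= _).
      by apply: ler_sum => j _.
    by rewrite sumr_const card_ord -[_ *+ _]mulr_natr divfK // pnatr_eq0.
  by have := Hdel _ Bb; lra.
rewrite sE (le_trans cic') //.
move: Hb; rewrite /phi.
have -> : \sum_i b 0 i *: w i = `|c'|^-1 *: \sum_i c' 0 i *: w i.
  by rewrite scaler_sumr; apply: eq_bigr => j _; rewrite mxE scalerA.
rewrite normrZ normfV normr_id [`|c'|^-1 * _]mulrC ler_pdivlMr // => Hb.
rewrite mulrAC ler_pdivlMr //.
by move: Hb; set a := `|c'|; set S := `|\sum_i _|; lra.
Qed.

End Caratheodory.

(** * Bounded multipliers from RCPLD *)

Section Multipliers.
Variables (R : realType) (n m p l : nat).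
Variables (f : 'rV[R]_n -> 'rV[R]_m -> R) (h : nat -> 'rV[R]_n -> 'rV[R]_m -> R).
Hypotheses (f1 : C1 f) (h1 : forall i : nat, (1 <= i <= p)%N -> C1 (h i)).

(** Index 0 carries [f] instead of [f - phi]: both have the same gradient in [y], and [phi] may be
    infinite or nonsmooth. *)
Definition objcon (i : 'I_p.+1) : 'rV[R]_n -> 'rV[R]_m -> R :=
  if val i == 0%N then f else h i.

Lemma objcon_C1 i : C1 (objcon i).
Proof.
rewrite /objcon; case: ifPn => [_|i0]; [exact: f1|apply: h1].
by rewrite lt0n i0 -ltnS ltn_ord.
Qed.

Lemma gfamE x y i : gfam f h x y i = grad_y (objcon i) x y.
Proof. by rewrite /gfam /objcon; case: ifP. Qed.

Lemma gfam_near xb yb (e : R) : 0 < e -> \forall q \near (xb, yb),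
  forall i : 'I_p.+1, `|gfam f h q.1 q.2 i - gfam f h xb yb i| <= e.
Proof.
move=> e0; apply: (@filter_forall _ _ _ _ (nbhs_filter (xb, yb))) => i.
have := @C1_grad_continuous _ _ _ _ (xb, yb) e (objcon_C1 i) e0.
by apply: filterS => q; rewrite !gfamE.
Qed.

(** Near the base point [T] stays independent and, by constant rank, spans the equality gradients.
    These are rewritten over [T], Caratheodory's reduction thins out the inequalities to an
    independent family, and the third condition of RCPLD then makes [coef_bound] applicable. *)
Lemma RCPLD_multipliers (Omega : set 'rV[R]_n) (xb : 'rV[R]_n) (yb : 'rV[R]_m) :
  Omega xb -> RCPLD_S p l f h Omega xb yb ->
  exists2 C : R, 0 < C & \forall q \near (xb, yb), Omega q.1 ->
    forall c : 'I_p.+1 -> R,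
    (forall i, i \notin Jset p l -> 0 <= c i) ->
    (forall i, i \notin Jset p l -> c i != 0 -> i \in ord0 |: Iact p l h xb yb) ->
    exists c', [/\ \sum_i c' i *: gfam f h q.1 q.2 i = \sum_i c i *: gfam f h q.1 q.2 i,
      forall i, i \notin Jset p l -> 0 <= c' i,
      forall i, i \notin Jset p l -> c' i != 0 -> c i != 0 &
      forall i, `|c' i| <= C * `|\sum_i c i *: gfam f h q.1 q.2 i| ].
Proof.
move=> Oxb [U [T [nU [TJ [[iTb [_ sTb]] [[r rk] dep]]]]]].
move: (Jset p l) TJ sTb rk => J TJ sTb rk.
pose vb : 'I_p.+1 -> 'rV[R]_m := gfam f h xb yb.
rewrite -/vb in iTb sTb.
(* Where [coef_bound] does not apply, [Q] is vacuous and the default [(1, 1)] serves, so constants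
   can be chosen for every [K]. *)
pose Q (K : {set 'I_p.+1}) (B : R * R) := [/\ 0 < B.1, 0 < B.2 &
    [disjoint K & T]%B -> ~ pos_lin_dep K T vb vb ->
    forall w : 'I_p.+1 -> 'rV[R]_m, (forall i, `|w i - vb i| <= B.2) ->
    forall c : 'I_p.+1 -> R, (forall i, i \in K -> 0 <= c i) ->
    forall i, i \in K :|: T -> `|c i| <= B.1 * `|\sum_(i in K :|: T) c i *: w i| ].
have /choice[B HB] : forall K, exists B, Q K B.
  move=> K.
  have [dKT|dKT] := boolP [disjoint K & T]%B; last first.
    by exists (1, 1); split => //= D; rewrite D in dKT.
  have [nd|/contrapT nd] := pselect (~ pos_lin_dep K T vb vb); last first.
    by exists (1, 1); split => //= _ /(_ nd).
  by have [C [d [C0 d0 H]]] := coef_bound dKT nd; exists (C, d); split.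
have rb : fam_rank J vb = r := rk xb yb (nbhs_singleton nU) Oxb.
(* The sum over the finitely many [K] dominates each individual constant. *)
have C0 : 0 < \sum_K (B K).1.
  rewrite (bigD1 finset.set0) //= ltr_wpDr //; first by apply: sumr_ge0 => K _; case: (HB K) => /ltW.
  by case: (HB finset.set0).
exists (\sum_K (B K).1) => //.
have CB K : (B K).1 <= \sum_K (B K).1.
  by rewrite (bigD1 K) //= lerDl; apply: sumr_ge0 => K' _; case: (HB K') => /ltW.
have nd : \forall q \near (xb, yb), forall K (i : 'I_p.+1),
    `|gfam f h q.1 q.2 i - vb i| <= (B K).2.
  apply: (@filter_forall _ _ _ _ (nbhs_filter (xb, yb))) => K.
  by apply: gfam_near; case: (HB K).
apply: filterS2 nU nd => -[x w] Uxw close Ox c c0 cact.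
rewrite /= in close Ox c0 cact *; set v : 'I_p.+1 -> 'rV[R]_m := gfam f h x w in close *.
(* The coefficient bound for empty [K] forces every vanishing combination over [T] to be trivial. *)
have iT : lin_indep T v.
  have dis : [disjoint (finset.set0 : {set 'I_p.+1}) & T]%B by rewrite finset.disjoints_subset finset.sub0set.
  have nd0 : ~ pos_lin_dep finset.set0 T vb vb.
    move=> [a [b [_ [[[i]|[i iT bi]]]]]]; first by rewrite inE.
    rewrite big1 ?add0r => [e|j]; last by rewrite inE.
    by apply: iTb; exists b; split => //; exists i.
  move=> [e [[i iT ei] e0]].
  have vac j : j \in (finset.set0 : {set 'I_p.+1}) -> 0 <= e j by rewrite inE.
  have [_ _ /(_ dis nd0 v (close finset.set0) e vac)] := HB finset.set0.
  by rewrite finset.set0U e0 normr0 mulr0 => /(_ i iT); rewrite normr_le0 (negbTE ei).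
(* Constant rank carries the value [#|T|] from the base point to [(x, w)], so [T] still spans the
   gradients over [J]. *)
have rJ : fam_rank J v = #|T|.
  have rx : fam_rank J v = r := rk x w Uxw Ox.
  by rewrite rx -rb; exact: fam_rank_basis.
have sT := span_of_fam_rank TJ iT rJ.
have /choice[E HE] : forall j, exists e : 'I_p.+1 -> R, j \in J ->
    v j = \sum_(i in T) e i *: v i.
  move=> j.
  have [jJ|jJ] := boolP (j \in J); last by exists (fun=> 0).
  by have [e ->] := sT j jJ; exists e.
pose K0 : {set 'I_p.+1} := [set i | (i \notin J) && (c i != 0)]%SET.
have K0T : [disjoint K0 & T]%B.
  rewrite disjoint_subset; apply/fintype.subsetP => i; rewrite !inE => /andP[iJ _].
  by apply: contra iJ => iT'; rewrite (fintype.subsetP TJ).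
pose c1 i := if i \in K0 then c i else \sum_(j in J) c j * E j i.
have c1E : \sum_(i in K0 :|: T) c1 i *: v i = \sum_i c i *: v i.
  rewrite sum_disjointU // [RHS](bigID (mem J)) [RHS]addrC; congr (_ + _); last first.
    rewrite (eq_bigr (fun i => \sum_(j in J) (c j * E j i) *: v i)); last first.
      by move=> i iT'; rewrite /c1 (disjointFl K0T iT') scaler_suml.
    rewrite exchange_big; apply: eq_bigr => j jJ /=; rewrite -[RHS]/(c j *: v j) [in RHS](HE j jJ) scaler_sumr.
    by apply: eq_bigr => i _; rewrite scalerA.
  rewrite big_mkcond [RHS]big_mkcond; apply: eq_bigr => i _.
  transitivity (if i \notin J then c i *: v i else 0); last by [].
  rewrite /c1 inE; case: (i \in J) => //=.
  by case: eqP => // ->; rewrite scale0r.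
have [|K [c2 [KK0 c20 iKT c2E]]] := caratheodory (c := c1) K0T iT.
  by move=> i iK0; rewrite /c1 iK0; move: iK0; rewrite inE => /andP[/c0].
have Kact : K \subset ord0 |: Iact p l h xb yb.
  apply/fintype.subsetP => i /(fintype.subsetP KK0); rewrite inE => /andP[iJ ci].
  exact: cact.
have KT : [disjoint K & T]%B := disjointWl KK0 K0T.
(* Contraposition of the third condition of RCPLD: independence over [K :|: T] at [(x, w)] excludes
   positive-linear dependence at the base point. *)
have nKT : ~ pos_lin_dep K T vb vb by move=> /(dep K Kact) /(_ x w Uxw Ox).
have [_ _ /(_ KT nKT v (close K) c2 c20) bd] := HB K.
pose c' i := if i \in K :|: T then c2 i else 0.
have c'E : \sum_i c' i *: v i = \sum_i c i *: v i.
  rewrite -c1E -c2E [RHS]big_mkcond; apply: eq_bigr => i _.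
  by rewrite /c'; case: ifP => _; rewrite ?scale0r.
have TnJ i : i \notin J -> i \in K :|: T -> i \in K.
  rewrite inE => iJ /orP[//|iT']; exfalso; move: iJ.
  by rewrite (fintype.subsetP TJ).
exists c'; split => //.
- by move=> i iJ; rewrite /c'; case: ifPn => // /(TnJ _ iJ)/c20.
- move=> i iJ; rewrite /c'; case: ifPn => [/(TnJ _ iJ) iK _|]; last by rewrite eqxx.
  by have := fintype.subsetP KK0 _ iK; rewrite inE => /andP[].
- move=> i; rewrite /c'; case: ifPn => iKT'; last by rewrite normr0 mulr_ge0 // ltW.
  apply: le_trans (bd _ iKT') _; rewrite c2E c1E.
  by rewrite ler_wpM2r.
Qed.

End Multipliers.

(** * Squared violations and stationarity of the penalized problem *)

Section Penalty.
Variables (R : realType) (m : nat).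

(** [true] marks an equality, whose violation is signed; [false] marks an inequality, whose
    violation is the positive part. *)
Definition viol (b : bool) (a : R) : R := if b then a else Num.max a 0.

Lemma viol_ge0 a : 0 <= viol false a.
Proof. by rewrite /viol le_max lexx orbT. Qed.

Lemma viol_gt0 a : viol false a != 0 -> 0 < a.
Proof. by rewrite /viol; case: ltP => // _; rewrite eqxx. Qed.

Lemma viol_le0 a : a <= 0 -> viol false a = 0.
Proof. by move=> a0; rewrite /viol; apply/max_idPr. Qed.

(* The right-hand side is smooth in [c] and has the same first-order expansion
   at [c = a] as the left-hand side: this bypasses differentiating a maximum. *)
Lemma viol_sqr_ub b a c :
  viol b c ^+ 2 <= viol b a ^+ 2 + 2 * viol b a * (c - a) + (c - a) ^+ 2.
Proof.
rewrite /viol; case: b; first by rewrite le_eqVlt; apply/orP; left; apply/eqP; ring.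
case: (ltP c 0) => c0; case: (ltP a 0) => a0.
- by have := sqr_ge0 (c - a); lra.
- by have := sqr_ge0 c; lra.
- have := mulr_ge0_le0 c0 (ltW a0); have := sqr_ge0 a; lra.
- lra.
Qed.

Lemma continuous_viol (T : topologicalType) b (g : T -> R) :
  continuous g -> continuous (fun x => viol b (g x)).
Proof.
rewrite /viol; case: b => // cg x.
exact: (@continuous_max _ _ g (cst 0) x (cg x) (@cst_continuous _ _ _ _)).
Qed.

Lemma is_derive_at_min (Q : R -> R) (dQ : R) (a : R) : 0 < a ->
  (forall t : R, derivable Q t 1) -> is_derive (0 : R) (1 : R) Q dQ ->
  (forall t : R, `|t| < a -> Q 0 <= Q t) -> dQ = 0.
Proof.
move=> a0 dQt dQ0 Qmin.
have [||||_ <-] := @derive1_at_min R Q (- a) a 0.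
- by lra.
- by move=> t _; exact: dQt.
- by rewrite in_itv /= oppr_lt0 a0.
- by move=> t; rewrite in_itv /= => ta; apply: Qmin; rewrite ltr_norml.
by rewrite derive_val.
Qed.

Variables (p : nat) (J : {set 'I_p.+1}) (g : 'I_p.+1 -> 'rV[R]_m -> R).

Definition pen (w : 'rV[R]_m) : R := \sum_i viol (i \in J) (g i w) ^+ 2.

Lemma pen_ge0 w : 0 <= pen w.
Proof. by apply: sumr_ge0 => i _; exact: sqr_ge0. Qed.

Lemma viol_le_pen i w : viol (i \in J) (g i w) ^+ 2 <= pen w.
Proof.
by rewrite /pen (bigD1 i) //= lerDl; apply: sumr_ge0 => j _; exact: sqr_ge0.
Qed.

(** The last term is a soft wall: it vanishes on the Euclidean ball of squared radius [rho] around
    [y] and, for large [M], keeps minimizers over a cube off its boundary. *)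
Definition penalized (y : 'rV[R]_m) (N M rho : R) (w : 'rV[R]_m) : R :=
  dot (w - y) (w - y) + N * pen w
  + M * viol false (dot (w - y) (w - y) - rho) ^+ 2.

Lemma continuous_pen : (forall i, continuous (g i)) -> continuous pen.
Proof.
move=> cg; apply: continuous_sum => i w.
have c := continuous_viol (b := i \in J) (cg i).
exact: (@continuousM _ _ _ _ w (c w) (c w)).
Qed.

Lemma continuous_penalized y N M rho :
  (forall i, continuous (g i)) -> continuous (penalized y N M rho).
Proof.
move=> cg w.
have cs := @continuous_sqdist R m y.
have csr : continuous (fun w : 'rV[R]_m => dot (w - y) (w - y) - rho).
  by move=> u; exact: (@continuousB _ _ _ _ (cst rho) u (cs u) (@cst_continuous _ _ _ _)).
have cv := continuous_viol (b := false) csr.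
have cc (c : R) : {for w, continuous (cst c : 'rV[R]_m -> R)} := @cst_continuous _ _ c w.
have cp : {for w, continuous pen} by exact: continuous_pen.
have c1 := @continuousM _ _ _ _ w (cc N) cp.
have c2 := @continuousM _ _ _ _ w (cc M) (@continuousM _ _ _ _ w (cv w) (cv w)).
exact: (@continuousD _ _ _ _ _ w (@continuousD _ _ _ _ _ w (cs w) c1) c2).
Qed.

(** Along each line through [w] the increment of [penalized] has a differentiable majorant that
    vanishes at 0. Since [w] is a local minimizer, 0 minimizes the majorant, and Fermat's rule gives
    the equation after division by 2. *)
Lemma penalized_stationary y N M rho w a : 0 <= N -> 0 <= M -> 0 < a ->
  (forall i z, differentiable (g i) z) ->
  (forall w', `|w' - w| < a -> penalized y N M rho w <= penalized y N M rho w') ->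
  forall v, (1 + 2 * M * viol false (dot (w - y) (w - y) - rho)) * dot (w - y) v
    + N * \sum_i viol (i \in J) (g i w) * 'd (g i) w v = 0.
Proof.
move=> N0 M0 a0 dg wmin v.
set be := viol false _.
pose S (t : R) : R := t * (2 * dot (w - y) v + t * dot v v).
pose U i (t : R) : R := g i (w + t *: v) - g i w.
pose al i := viol (i \in J) (g i w).
have sE t : dot (w + t *: v - y) (w + t *: v - y) = dot (w - y) (w - y) + S t.
  rewrite addrAC /S; move: (w - y) => u.
  rewrite dotDl !dotDr !dotZl !dotZr (dotC v u); ring.
(* The majorant from [viol_sqr_ub]; [S] is the increment of the squared distance and [U i] that of
   [g i]. *)
pose Q := (1 + 2 * M * be) \*: S + M \*: (S ^+ 2)
   + N \*: (\sum_i ((2 * al i) \*: U i + U i ^+ 2)).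
have QE t : Q t = (1 + 2 * M * be) * S t + M * S t ^+ 2
   + N * \sum_i (2 * al i * U i t + U i t ^+ 2).
  by rewrite /Q /= !fctE fct_sumE.
have U0 i : U i 0 = 0 by rewrite /U scale0r addr0 subrr.
have S0 : S 0 = 0 by rewrite /S mul0r.
have Q0 : Q 0 = 0.
  rewrite QE S0 big1 => [|i _]; first ring.
  by rewrite U0; ring.
have dU i (t : R) : is_derive t (1 : R) (U i) ('d (g i) (w + t *: v) v).
  rewrite -[X in is_derive _ _ _ X]subr0.
  have dl := @is_derive_line R m (g i) w v t (dg i _).
  exact: (@is_deriveB _ _ _ _ (cst (g i w)) _ _ _ _ dl (is_derive_cst _ _ _)).
pose dS (t : R) : R := 2 * dot (w - y) v + 2 * t * dot v v.
have dS_ (t : R) : is_derive t (1 : R) S (dS t).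
  have -> : S = (2 * dot (w - y) v) \*: id + (dot v v) \*: (id ^+ 2).
    by apply: funext => s; rewrite /S /= !fctE /= /GRing.scale /=; ring.
  have d2 := @is_deriveX _ _ id 2 t 1 1 (is_derive_id t 1).
  have d3 := @is_deriveD _ _ _ _ _ _ _ _ _
    (@is_deriveZ _ _ _ _ (2 * dot (w - y) v) _ _ _ (is_derive_id t (1 : R)))
    (@is_deriveZ _ _ _ _ (dot v v) _ _ _ d2).
  apply: (@is_derive_eq _ _ _ _ _ _ _ _ d3).
  by rewrite /dS /GRing.scale /= expr1; ring.
pose dQ (t : R) : R := (1 + 2 * M * be) * dS t + M * (2 * S t * dS t)
  + N * \sum_i (2 * al i * 'd (g i) (w + t *: v) v
                + 2 * U i t * 'd (g i) (w + t *: v) v).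
have dQ_ (t : R) : is_derive t (1 : R) Q (dQ t).
  have dsq (u : R -> R) (du : R) : is_derive t (1 : R) u du ->
      is_derive t (1 : R) (u ^+ 2) (2 * u t * du).
    by move=> du_; have := @is_deriveX _ _ u 2 t 1 du du_; rewrite /= expr1.
  have d1 := @is_deriveZ _ _ _ _ (1 + 2 * M * be) _ _ _ (dS_ t).
  have d2 := @is_deriveZ _ _ _ _ M _ _ _ (dsq _ _ (dS_ t)).
  have d3 i := @is_deriveD _ _ _ _ _ _ _ _ _
    (@is_deriveZ _ _ _ _ (2 * al i) _ _ _ (dU i t)) (dsq _ _ (dU i t)).
  have d4 := @is_deriveZ _ _ _ _ N _ _ _ (@is_derive_sum _ _ _ _ _ _ _ _ d3).
  exact: (@is_deriveD _ _ _ _ _ _ _ _ _ (@is_deriveD _ _ _ _ _ _ _ _ _ d1 d2) d4).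
(* Adding 1 covers [v = 0]. *)
have b0 : 0 < a / (`|v| + 1) by rewrite divr_gt0 // ltr_wpDl.
have : dQ 0 = 0.
  have dQt (t : R) : derivable Q t 1 by have [] := dQ_ t.
  apply: (is_derive_at_min b0 dQt (dQ_ 0)) => t ta; rewrite Q0.
  have := wmin (w + t *: v).
  rewrite addrAC subrr add0r normrZ => /(_ _) wle.
  have {}wle : penalized y N M rho w <= penalized y N M rho (w + t *: v).
    apply: wle; move: ta; rewrite ltr_pdivlMr ?ltr_wpDl // => ta.
    by apply: le_lt_trans ta; rewrite ler_wpM2l // lerDl.
  apply: le_trans (_ : penalized y N M rho (w + t *: v) - penalized y N M rho w <= _).
    by rewrite subr_ge0.
  rewrite /penalized sE QE.
  have h1 : pen (w + t *: v) <= pen w + \sum_i (2 * al i * U i t + U i t ^+ 2).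
    rewrite /pen -big_split; apply: ler_sum => i _ /=.
    by apply: le_trans (viol_sqr_ub _ (g i w) _) _; rewrite addrA.
  have h2 := viol_sqr_ub false (dot (w - y) (w - y) - rho) (dot (w - y) (w - y) + S t - rho).
  rewrite -/be in h2 *.
  have {}h1 := ler_wpM2l N0 h1.
  have {}h2 := ler_wpM2l M0 h2.
  move: h1 h2; set s0 := dot (w - y) (w - y).
  have -> : s0 + S t - rho - (s0 - rho) = S t by ring.
  set V := viol false (s0 + S t - rho).
  set P1 := pen (w + t *: v); set P0 := pen w; set SU := \sum_i _ => h1 h2.
  rewrite !mulrDr in h1 h2 *; lra.
rewrite /dQ /dS S0 scale0r addr0.
under eq_bigr => i _ do rewrite U0 mulr0 mul0r addr0 -mulrA.
rewrite -mulr_sumr.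
set X := dot (w - y) v; set Y := \sum_i _; move=> H; nra.
Qed.

End Penalty.

(** * The distance estimate for minimizers of the penalized problem *)

Section Estimate.
Variables (R : realType) (n m p l : nat).
Variables (f : 'rV[R]_n -> 'rV[R]_m -> R) (h : nat -> 'rV[R]_n -> 'rV[R]_m -> R).
Hypotheses (f1 : C1 f) (h1 : forall i : nat, (1 <= i <= p)%N -> C1 (h i)).
Hypothesis lp : (l <= p)%N.

(** Take the minimum of finitely many radii; starting it at 1 covers an empty index type. *)
Lemma uniform_radius (I : finType) (P : I -> R -> Prop) :
  (forall i d d', 0 < d' <= d -> P i d -> P i d') ->
  (forall i, exists2 d, 0 < d & P i d) -> exists2 d, 0 < d & forall i, P i d.
Proof.
move=> mono ex.
have /choice[d Hd] : forall i, exists d, 0 < d /\ P i d.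
  by move=> i; have [d] := ex i; exists d.
have d0 : 0 < \big[Num.min/(1:R)]_(i : I) d i.
  by apply: lt_bigmin => // i _; case: (Hd i).
exists (\big[Num.min/(1:R)]_(i : I) d i) => // i.
apply: mono (proj2 (Hd i)); rewrite d0 /=; exact: bigmin_le_cond.
Qed.

(* The constraint functions of the system describing [S(x)] when [c] is the
   value [phi(x)]. *)
Definition residual (x : 'rV[R]_n) (c : R) (i : 'I_p.+1) (w : 'rV[R]_m) : R :=
  objcon f h i x w - (if val i == 0%N then c else 0).

Lemma residual_con x c (i : 'I_p.+1) w : val i != 0%N -> residual x c i w = h i x w.
Proof. by move=> /negbTE i0; rewrite /residual /objcon i0 subr0. Qed.

Lemma residual_obj x c w : residual x c ord0 w = f x w - c.
Proof. by []. Qed.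

Lemma Jset0 : ord0 \notin Jset p l.
Proof. by rewrite inE. Qed.

Lemma Jset_neq0 (i : 'I_p.+1) : i \in Jset p l -> val i != 0%N.
Proof. by rewrite inE -lt0n; exact: leq_trans. Qed.

Lemma notin_Jset (i : 'I_p.+1) : i \notin Jset p l -> i != ord0 -> i \in Iset p l.
Proof. by rewrite !inE -leqNgt -val_eqE /= lt0n => -> ->. Qed.

Lemma differentiable_residual x c i w : differentiable (residual x c i) w.
Proof.
apply: differentiableB; last exact: differentiable_cst.
exact/C1_slice/objcon_C1.
Qed.

Lemma diff_residual x c i w v :
  'd (residual x c i) w v = dot (gfam f h x w i) v.
Proof.
rewrite /residual diffB; last 2 first.
- exact/C1_slice/objcon_C1.
- exact: differentiable_cst.
by rewrite diff_cst /= subr0 gfamE diff_grad_y.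
Qed.

Lemma continuous_residual x c i : continuous (residual x c i).
Proof.
by move=> w; apply: differentiable_continuous; exact: differentiable_residual.
Qed.

Lemma compact_cube (y : 'rV[R]_m) (e : R) : compact [set w : 'rV[R]_m | `|w - y| <= e].
Proof.
have -> : [set w : 'rV[R]_m | `|w - y| <= e] = closed_ball_ Num.norm y e.
  by apply/seteqP; split => w /=; rewrite distrC.
apply: bounded_closed_compact; last exact: closed_closed_ball_.
exists (`|y| + e); split; first exact: num_real.
move=> M ltM w; rewrite /closed_ball_ /= distrC => wy; apply: ltW; apply: le_lt_trans ltM.
by rewrite -[w](subrK y) addrC (le_trans (ler_normD _ _)) // lerD2l.
Qed.

(** By continuity an inequality that is strict at the base point stays strict nearby, so only active
    ones can be violated there. *)
Lemma near_inactive_neg xb yb : Gamma p l h xb yb ->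
  \forall q \near (xb, yb), forall i : 'I_p.+1, i \in Iset p l ->
    0 < h i q.1 q.2 -> i \in Iact p l h xb yb.
Proof.
move=> [hI _]; apply: (@filter_forall _ _ _ _ (nbhs_filter (xb, yb))) => i.
have [iI|iI] := boolP (i \in Iset p l); last by near=> q.
have [ih|ih] := boolP (i \in Iact p l h xb yb); first by near=> q.
have hn : h i xb yb < 0.
  rewrite lt_neqAle hI // andbT; apply: contra ih => /eqP hi.
  by rewrite /Iact inE iI hi eqxx.
have i0 : (1 <= i <= p)%N.
  by move: iI; rewrite inE => /andP[-> il]; exact: leq_trans il lp.
have := @C1_continuous _ _ _ _ (h1 i0) (xb, yb).
move=> /(@cvgr_lt _ _ _ _) /(_ 0 hn).
apply: filterS => q hq _ hq0.
by have := lt_trans hq hq0; rewrite ltxx.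
Unshelve. all: by end_near.
Qed.

(** With [r] the distance from [y] to [w] and [H = f x y - c], stationarity, bounded multipliers and
    strict differentiability give [r ^+ 2 <= p.+1%:R * (C * r * (H + om * r))], hence
    [r <= kappa * H]. The constants [kappa] and [e0] are fixed before [x], [y], [c], [rho] and
    [N]. *)
Lemma penalized_estimate (Omega : set 'rV[R]_n) (xb : 'rV[R]_n) (yb : 'rV[R]_m) :
  Omega xb -> Gamma p l h xb yb -> RCPLD_S p l f h Omega xb yb ->
  exists kappa e0 : R, [/\ 0 < kappa, 0 < e0 & forall e : R, 0 < e <= e0 ->
    forall (x : 'rV[R]_n) (y : 'rV[R]_m) (c rho N : R),
    `|x - xb| < e -> `|y - yb| < e -> Omega x -> Gamma p l h x y -> c <= f x y ->
    0 < N -> 0 < rho < e ^+ 2 ->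
    exists w : 'rV[R]_m, [/\ `|w - y| <= e, `|w - y| <= kappa * (f x y - c) &
      forall w' : 'rV[R]_m, `|w' - y| <= e -> dot (w' - y) (w' - y) <= rho ->
      dot (w - y) (w - y) + N * pen (Jset p l) (residual x c) w <=
      dot (w' - y) (w' - y) + N * pen (Jset p l) (residual x c) w']].
Proof.
move=> Oxb Gb rc.
have [C C0 /nbhs_ballP[d1 /= d10 mult]] := RCPLD_multipliers f1 h1 Oxb rc.
have p0 : 0 < p.+1%:R :> R by rewrite ltr0n.
(* Makes the quadratic error term equal to [r ^+ 2 / 2], which the left-hand side absorbs. *)
pose om := (2 * p.+1%:R * C)^-1.
have om0 : 0 < om by rewrite invr_gt0 !mulr_gt0.
have [d2 d20 strict] : exists2 d, 0 < d & forall i : 'I_p.+1, forall (x : 'rV[R]_n) (y w : 'rV[R]_m),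
    `|x - xb| < d -> `|y - yb| < d -> `|w - yb| < d ->
    `|objcon f h i x y - objcon f h i x w - dot (gfam f h x w i) (y - w)| <= om * `|y - w|.
  apply: (@uniform_radius _ (fun i d => forall (x : 'rV[R]_n) (y w : 'rV[R]_m),
    `|x - xb| < d -> `|y - yb| < d -> `|w - yb| < d ->
    `|objcon f h i x y - objcon f h i x w - dot (gfam f h x w i) (y - w)| <= om * `|y - w|)).
    move=> i d d' /andP[_ dd'] H x y w xd yd wd.
    by apply: H; apply: lt_le_trans dd'.
  move=> i; have [d d0 H] := C1_strict_grad xb yb (objcon_C1 f1 h1 i) om0.
  by exists d => // x y w xd yd wd; rewrite gfamE; exact: H.
have /nbhs_ballP[d3 /= d30 act] := near_inactive_neg Gb.
pose dm := Num.min d1 (Num.min d2 d3).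
have dm0 : 0 < dm by rewrite !lt_min d10 d20.
(* Half of [dm], because [w] is within [e] of [y] and [y] within [e] of [yb]. *)
exists (2 * p.+1%:R * C), (dm / 2); split; rewrite ?divr_gt0 ?mulr_gt0 //.
move=> e /andP[e0 edm2] x y c rho N xe ye Ox Gy cf N0 /andP[rho0 rhoe].
have edm : e < dm by lra.
have e2dm : e + e <= dm by lra.
set H := f x y - c.
have H0 : 0 <= H by rewrite subr_ge0.
set J := Jset p l; set g := residual x c.
have gyI i : i \notin J -> g i y <= H.
  move=> iJ; have [->|i0] := eqVneq i ord0; first by rewrite /g residual_obj.
  rewrite /g residual_con //; apply: le_trans H0.
  by case: Gy => /(_ i (notin_Jset iJ i0)).
have gyJ i : i \in J -> g i y = 0.
  by move=> iJ; rewrite /g residual_con ?Jset_neq0 //; case: Gy => _ ->.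
(* Since [y] is feasible, only the objective constraint contributes. *)
have peny : pen J g y = H ^+ 2.
  rewrite /pen (bigD1 ord0) //= big1 ?addr0 => [|i i0].
    rewrite (negbTE Jset0) /g residual_obj -/H /viol.
    by rewrite (max_idPl H0).
  have [iJ|iJ] := boolP (i \in J); first by rewrite gyJ // /viol expr0n.
  rewrite viol_le0 ?expr0n // /g residual_con //.
  by case: Gy => /(_ i (notin_Jset iJ i0)).
(* On the boundary of the cube the squared distance is at least [e ^+ 2], so the wall alone costs at
   least [N * H ^+ 2 + 1], more than the value at [y]. *)
pose M := (N * H ^+ 2 + 1) / (e ^+ 2 - rho) ^+ 2.
have er0 : 0 < e ^+ 2 - rho by rewrite subr_gt0.
have M0 : 0 < M by rewrite divr_gt0 ?exprn_gt0 // ltr_wpDl // mulr_ge0 ?sqr_ge0 // ltW.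
pose G := penalized J g y N M rho.
have Gyy : G y = N * H ^+ 2.
  rewrite /G /penalized subrr dot0l peny viol_le0; last by lra.
  by rewrite expr0n mulr0 addr0 add0r.
have cG : continuous G by apply: continuous_penalized => i; exact: continuous_residual.
have cube0 : [set w : 'rV[R]_m | `|w - y| <= e] !=set0.
  by exists y; rewrite /= subrr normr0 ltW.
have [w /set_mem /= we wmin0] :=
  EVT_min_rV cube0 (@compact_cube y e) (continuous_subspaceT cG).
have wmin w' : `|w' - y| <= e -> G w <= G w' by move=> ?; apply: wmin0; rewrite inE.
have GwE : N * H ^+ 2 >= G w by rewrite -Gyy; apply: wmin; rewrite subrr normr0 ltW.
set be := viol false (dot (w - y) (w - y) - rho).
have be0 : 0 <= be := viol_ge0 _.
have dw0 := dot_ge0 (w - y).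
have pw0 := pen_ge0 J g w.
have Gw : G w = dot (w - y) (w - y) + N * pen J g w + M * be ^+ 2 by [].
have Npw0 : 0 <= N * pen J g w by rewrite mulr_ge0 // ltW.
have Mbe0 : 0 <= M * be ^+ 2 by rewrite mulr_ge0 ?sqr_ge0 // ltW.
have wlt : `|w - y| < e.
  rewrite ltNge; apply/negP => ew.
  have h2 : e ^+ 2 <= dot (w - y) (w - y).
    apply: le_trans (norm_sqr_le_dot _).
    by rewrite ler_sqr ?nnegrE // ltW.
  have h3 : e ^+ 2 - rho <= be.
    by rewrite /be /viol le_max lerD2r h2.
  have h4 : (e ^+ 2 - rho) ^+ 2 <= be ^+ 2 by rewrite ler_sqr ?nnegrE // ltW.
  have h5 : N * H ^+ 2 + 1 <= M * be ^+ 2.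
    apply: le_trans (ler_wpM2l (ltW M0) h4).
    by rewrite /M divfK // gt_eqF // exprn_gt0.
  by move: GwE dw0 Npw0 h5; rewrite Gw; clear; lra.
(* Comparison with [y]; it later bounds the equality residuals at [w] by [H]. *)
have pwH : pen J g w <= H ^+ 2.
  by rewrite -(ler_pM2l N0); move: GwE dw0 Mbe0; rewrite Gw; clear; lra.
have a0 : 0 < e - `|w - y| by rewrite subr_gt0.
have stat := @penalized_stationary R m p J g y N M rho w _ (ltW N0) (ltW M0) a0
  (fun i z => differentiable_residual x c i z).
have {}stat v : (1 + 2 * M * be) * dot (w - y) v
    + N * \sum_i viol (i \in J) (g i w) * dot (gfam f h x w i) v = 0.
  under eq_bigr => i _ do rewrite -(@diff_residual x c).
  apply: stat => w' ww'; apply: wmin.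
  have -> : w' - y = (w' - w) + (w - y) by rewrite addrA subrK.
  apply: le_trans (ler_normD _ _) _; rewrite -lerBrDr; exact: ltW.
pose s := 1 + 2 * M * be.
have s0 : 0 < s.
  have MB : 0 <= M * be := mulr_ge0 (ltW M0) be0.
  by rewrite /s -mulrA ltr_wpDr // mulr_ge0.
pose co i := N * viol (i \in J) (g i w) / s.
(* The stationarity equation divided by [s], read coordinate by coordinate. *)
have coE : \sum_i co i *: gfam f h x w i = y - w.
  apply/rowP => j; rewrite -!dot_delta dot_suml.
  have := stat (delta_mx 0 j); rewrite -/s => sj.
  rewrite -opprB -scaleN1r dotZl mulN1r; apply: (mulfI (lt0r_neq0 s0)).
  rewrite mulrN; move/eqP: sj; rewrite addrC addr_eq0 => /eqP <-.
  rewrite !mulr_sumr; apply: eq_bigr => i _; rewrite dotZl /co.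
  by move: (dot _ _) (viol _ _) (lt0r_neq0 s0) => D V s1; field.
have wyb : `|w - yb| < dm.
  have -> : w - yb = (w - y) + (y - yb) by rewrite addrA subrK.
  by rewrite (le_lt_trans (ler_normD _ _)) // (lt_le_trans _ e2dm) // ltrD.
have [xd1 xd2 xd3] : [/\ `|x - xb| < d1, `|x - xb| < d2 & `|x - xb| < d3].
  by have := lt_trans xe edm; rewrite !lt_min => /and3P.
have [wd1 wd2 wd3] : [/\ `|w - yb| < d1, `|w - yb| < d2 & `|w - yb| < d3].
  by move: wyb; rewrite !lt_min => /and3P.
have yd2 : `|y - yb| < d2.
  by have := lt_trans ye edm; rewrite !lt_min => /and3P[].
have co0 i : i \notin J -> 0 <= co i.
  by move=> /negbTE iJ; rewrite /co iJ !mulr_ge0 ?invr_ge0 ?viol_ge0 // ltW.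
have co_pos i : i \notin J -> co i != 0 -> 0 < g i w.
  move=> /negbTE iJ; rewrite /co iJ => coi; apply: viol_gt0.
  by apply: contra coi => /eqP ->; rewrite mulr0 mul0r.
have coact i : i \notin J -> co i != 0 -> i \in ord0 |: Iact p l h xb yb.
  move=> iJ coi; rewrite in_setU1; have [//|i0 /=] := eqVneq i ord0.
  have xw : ball (xb, yb) d3 (x, w) by split; rewrite -ball_normE /= distrC.
  apply: (act (x, w) xw i (notin_Jset iJ i0)).
  by have := co_pos i iJ coi; rewrite /g residual_con.
have xw : ball (xb, yb) d1 (x, w) by split; rewrite -ball_normE /= distrC.
have [c' [c'E c'0 c'co c'C]] := mult (x, w) xw Ox co co0 coact.
rewrite /= coE in c'E c'C.
set r := `|y - w| in c'C.
have r0 : 0 <= r := normr_ge0 _.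
have str i : `|g i y - g i w - dot (gfam f h x w i) (y - w)| <= om * r.
  have := strict i x y w xd2 yd2 wd2; rewrite /g /residual.
  set A := objcon _ _ _ _ _; set B := objcon _ _ _ _ _.
  by have -> : A - B = A - (if val i == 0%N then c else 0) - (B - (if val i == 0%N then c else 0)) by ring.
(* Equalities need a two-sided bound, from [g i y = 0] and [pwH]. For inequalities [c' i] is
   nonnegative and an upper bound suffices: a nonzero [c' i] means [g i w > 0], while
   [g i y <= H]. *)
have term i : c' i * dot (gfam f h x w i) (y - w) <= C * r * (H + om * r).
  have omr : 0 <= om * r by rewrite mulr_ge0 // ltW.
  have Cr : 0 <= C * r by rewrite mulr_ge0 // ltW.
  have := str i; rewrite ler_norml => /andP[sl su].
  set D := dot _ _ in sl su *.
  have [iJ|iJ] := boolP (i \in J).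
    apply: le_trans (ler_norm _) _; rewrite normrM ler_pM //.
    have gw : `|g i w| <= H.
      rewrite -ler_sqr ?nnegrE // (real_normK (num_real _)); apply: le_trans pwH.
      by have := viol_le_pen J g i w; rewrite iJ.
    move: sl su gw; rewrite gyJ // !ler_norml => sl su /andP[gl gu].
    by apply/andP; move: sl su gl gu; clear; split; lra.
  have [c'i|c'i] := eqVneq (c' i) 0; first by rewrite c'i mul0r mulr_ge0 // addr_ge0.
  have gi := co_pos i iJ (c'co i iJ c'i).
  have DH : D <= H + om * r by move: (gyI i iJ) sl gi; clear; lra.
  have ci : c' i <= C * r := le_trans (ler_norm _) (c'C i).
  exact: le_trans (ler_wpM2l (c'0 i iJ) DH) (ler_wpM2r (addr_ge0 H0 omr) ci).
have r2 : r ^+ 2 <= p.+1%:R * (C * r * (H + om * r)).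
  apply: le_trans (norm_sqr_le_dot _) _.
  rewrite -{1}c'E dot_suml.
  rewrite (_ : p.+1%:R * _ = \sum_(i < p.+1) (C * r * (H + om * r))).
    by apply: ler_sum => i _; rewrite dotZl; exact: term.
  by rewrite sumr_const card_ord mulr_natl.
have rH : r <= 2 * p.+1%:R * C * H.
  have [->|rn0] := eqVneq r 0; first by rewrite !mulr_ge0 // ltW.
  have rp : 0 < r by rewrite lt_neqAle eq_sym rn0.
  have half : p.+1%:R * (C * r * (H + om * r)) = p.+1%:R * C * H * r + r ^+ 2 / 2.
    by rewrite /om; field; rewrite !gt_eqF // ltr0n.
  rewrite half in r2.
  by rewrite -(ler_pM2l rp); move: r2; rewrite expr2; clear; lra.
(* The wall vanishes at [w'], and dropping it at [w] only lowers the left-hand side. *)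
exists w; split => //; first by rewrite distrC.
move=> w' w'e w'rho; have := wmin w' w'e.
rewrite Gw /G /penalized (viol_le0 (a := _ - rho)); last by rewrite subr_le0.
by rewrite expr0n mulr0 addr0; move: Mbe0; clear; lra.
Qed.

End Estimate.

(** * Zeros of the penalty, semicontinuity of values and solutions, convexity *)

Section ErrorBound.
Variables (R : realType) (n m p l : nat).
Variables (f : 'rV[R]_n -> 'rV[R]_m -> R) (h : nat -> 'rV[R]_n -> 'rV[R]_m -> R).
Hypotheses (f1 : C1 f) (h1 : forall i : nat, (1 <= i <= p)%N -> C1 (h i)).
Local Notation J := (Jset p l).
Local Notation Gam := (Gamma p l h).
Local Notation S := (Ssol p l f h).

Lemma pen_eq0P (g : 'I_p.+1 -> 'rV[R]_m -> R) w :
  pen J g w <= 0 <->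
  (forall i, i \notin J -> g i w <= 0) /\ (forall i, i \in J -> g i w = 0).
Proof.
split=> [pw|[gI gJ]]; last first.
  rewrite /pen big1 // => i _; have [iJ|iJ] := boolP (i \in J).
    by rewrite gJ // /viol expr0n.
  by rewrite viol_le0 ?gI // expr0n.
have v0 i : viol (i \in J) (g i w) = 0.
  apply/eqP; rewrite -sqrf_eq0 eq_le sqr_ge0 andbT.
  exact: le_trans (viol_le_pen J g i w) pw.
split=> i iJ; have := v0 i; last by rewrite iJ.
by rewrite (negbTE iJ) /viol => <-; rewrite le_max lexx.
Qed.

(** For [c] the optimal value at [x], the right-hand side says that [w] solves the lower-level
    problem. *)
Lemma pen_residual_eq0 x c w : pen J (residual f h x c) w <= 0 <-> Gam x w /\ f x w <= c.
Proof.
rewrite pen_eq0P; split=> [[gI gJ]|[[hI hJ] fc]].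
  split; last by have := gI ord0 (Jset0 p l); rewrite residual_obj subr_le0.
  split=> i; rewrite inE => Hi.
    have iJ : i \notin J by rewrite inE -leqNgt; case/andP: Hi.
    have := gI i iJ; rewrite residual_con // -lt0n; by case/andP: Hi.
  have iJ : i \in J by rewrite inE.
  by have := gJ i iJ; rewrite residual_con // (Jset_neq0 iJ).
split=> i iJ; last by rewrite residual_con ?(Jset_neq0 iJ) // hJ.
have [->|i0] := eqVneq i ord0; first by rewrite residual_obj subr_le0.
by rewrite residual_con // hI // notin_Jset.
Qed.

Lemma Ssol_phi x s : S x s -> phi p l f h x = (f x s)%:E.
Proof.
move=> [Gs smin]; rewrite /phi; apply/eqP; rewrite eq_le; apply/andP; split.
  by apply: ereal_inf_lbound; exists s.
by apply: le_ereal_inf_tmp => _ [z Gz <-]; rewrite lee_fin smin.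
Qed.

(** Turns closeness in the maximum norm into membership in the Euclidean ball of squared radius
    [e ^+ 2 / 2], the value used for [rho]. *)
Lemma dot_small (u : 'rV[R]_m) (e : R) : 0 < e -> `|u| <= e / (2 * m.+1%:R) ->
  dot u u < e ^+ 2 / 2.
Proof.
move=> e0 ue; apply: le_lt_trans (dot_le_norm_sqr u) _.
have m0 : 0 < m.+1%:R :> R by rewrite ltr0n.
have u2 : `|u| ^+ 2 <= (e / (2 * m.+1%:R)) ^+ 2.
  by rewrite ler_sqr ?nnegrE // divr_ge0 // ?mulr_ge0 // ltW.
apply: le_lt_trans (_ : m.+1%:R * (e / (2 * m.+1%:R)) ^+ 2 < _).
  by rewrite ler_pM // ?sqr_ge0 // ler_nat.
have -> : m.+1%:R * (e / (2 * m.+1%:R)) ^+ 2 = e ^+ 2 / 4 / m.+1%:R.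
  by field; rewrite gt_eqF.
rewrite ltr_pdivrMr //.
have e2 : 0 < e ^+ 2 by rewrite exprn_gt0.
have : 1 <= m.+1%:R :> R by rewrite ler1n.
move: (m.+1%:R : R) (e ^+ 2) m0 e2 => a b a0 b0 a1; nra.
Qed.

(* The minimizers of the penalized problems accumulate, as [N] tends to
   infinity, at a zero of the penalty. *)
Lemma solution_of_penalized x y s (e K D : R) : S x s -> 0 <= e -> 0 <= K ->
  (forall N : R, 0 < N -> exists w : 'rV[R]_m, [/\ `|w - y| <= e, `|w - y| <= K &
     N * pen J (residual f h x (f x s)) w <= D]) ->
  exists z : 'rV[R]_m, [/\ S x z, `|z - y| <= e & `|z - y| <= K].
Proof.
move=> Ss e0 K0 HN; set P := pen J (residual f h x (f x s)) in HN.
pose A := [set w : 'rV[R]_m | `|w - y| <= Num.min e K].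
have A0 : A !=set0 by exists y; rewrite /A /= subrr normr0 le_min e0.
have cP : continuous P by apply: continuous_pen => i; exact: continuous_residual.
(* In place of a limit of minimizers, take a minimizer of the penalty over the cube; its value is at
   most [D / N] for every [N]. *)
have [z /set_mem /= zy zmin] :=
  EVT_min_rV A0 (@compact_cube R m y (Num.min e K)) (continuous_subspaceT cP).
move: zy; rewrite /A /= le_min => /andP[ze zK].
have : P z <= 0.
  rewrite leNgt; apply/negP => Pz.
  have N0 : 0 < (`|D| + 1) / P z by rewrite divr_gt0 // ltr_wpDl.
  have [w [we wK Pw]] := HN _ N0.
  have : P z <= P w by apply: zmin; rewrite inE /A /= le_min we.
  move=> /(ler_wpM2l (ltW N0)) /le_trans /(_ Pw).
  rewrite divfK ?gt_eqF // => DD.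
  by have := ler_norm D; lra.
move=> /pen_residual_eq0[Gz fz]; exists z; split=> //; split=> // z' Gz'.
by apply: le_trans fz _; case: Ss => _; apply.
Qed.

(** The zero function at index 0 makes the penalty measure infeasibility for [Gamma] alone. *)
Definition con (i : 'I_p.+1) (x : 'rV[R]_n) (w : 'rV[R]_m) : R :=
  if val i == 0%N then 0 else h i x w.

Lemma Gamma_pen x w : Gam x w <-> pen J (con ^~ x) w <= 0.
Proof.
rewrite pen_eq0P; split=> [[hI hJ]|[gI gJ]].
  split=> i iJ; rewrite /con; last by rewrite (negbTE (Jset_neq0 iJ)) hJ.
  case: ifPn => // i0; apply: hI; exact: notin_Jset.
split=> i; rewrite inE => Hi.
  have iJ : i \notin J by rewrite inE -leqNgt; case/andP: Hi.
  have := gI i iJ; rewrite /con gtn_eqF //; by case/andP: Hi.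
have iJ : i \in J by rewrite inE.
by have := gJ i iJ; rewrite /con (negbTE (Jset_neq0 iJ)).
Qed.

Lemma con_continuous i : continuous (fun q : 'rV[R]_n * 'rV[R]_m => con i q.1 q.2).
Proof.
rewrite /con; case: (boolP (val i == 0%N)) => i0; first by move=> q; exact: cst_continuous.
by apply/C1_continuous/h1; rewrite lt0n i0 -ltnS ltn_ord.
Qed.

Lemma con_pen_continuous :
  continuous (fun q : 'rV[R]_n * 'rV[R]_m => pen J (con ^~ q.1) q.2).
Proof.
apply: continuous_sum => i q.
have c := continuous_viol (b := i \in J) (@con_continuous i).
exact: (@continuousM _ _ _ _ q (c q) (c q)).
Qed.

Lemma Gamma_closed x : closed (Gam x).
Proof.
have -> : Gam x = (fun w => pen J (con ^~ x) w) @^-1` [set a | a <= 0].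
  by apply/seteqP; split => w /Gamma_pen.
apply: closed_comp; last exact: closed_le.
move=> w _; apply: continuous_pen => i; rewrite /con; case: (boolP (val i == 0%N)) => i0.
  by move=> u; exact: cst_continuous.
by apply: C1_continuous_slice; apply: h1; rewrite lt0n i0 -ltnS ltn_ord.
Qed.

Lemma Ssol_nonempty x (M : R) : Gam x !=set0 -> (forall y, Gam x y -> `|y| <= M) ->
  exists s, S x s.
Proof.
move=> G0 GM.
have cG : compact (Gam x).
  apply: bounded_closed_compact; last exact: Gamma_closed.
  exists M; split; first exact: num_real.
  by move=> M' MM' y /GM yM; rewrite /= (le_trans yM) // ltW.
have cf : continuous (f x) by exact: C1_continuous_slice.
have [s /set_mem Gs smin] := EVT_min_rV G0 cG (continuous_subspaceT cf).
by exists s; split => // z Gz; apply: smin; rewrite inE.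
Qed.

Lemma near_continuous_gt (T : topologicalType) (g : T -> R) (q0 : T) (a : R) :
  continuous g -> a < g q0 -> \forall q \near q0, a < g q.
Proof. by move=> cg ag; have /cvgr_gt := cg q0; exact. Qed.

Lemma near_continuous_lt (T : topologicalType) (g : T -> R) (q0 : T) (a : R) :
  continuous g -> g q0 < a -> \forall q \near q0, g q < a.
Proof. by move=> cg ag; have /cvgr_lt := cg q0; exact. Qed.

(** Compactness of a cube containing all nearby [Gam x]. Around [(xb, z)] with [z] feasible the
    bound follows from optimality of [yb] and continuity of [f]; around an infeasible [z] the
    penalty stays positive, so nothing is feasible. *)
Lemma value_lsc xb yb (e : R) : S xb yb -> loc_bounded_Gamma p l h xb -> 0 < e ->
  \forall x \near xb, forall z, Gam x z -> f xb yb - e < f x z.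
Proof.
move=> [Gb bmin] [B [M [BM [V [nV VB]]]]] e0.
pose P (x : 'rV[R]_n) (z : 'rV[R]_m) := Gam x z -> f xb yb - e < f x z.
have /compact_near_coveringP := @compact_cube R m 0 M.
move=> /(_ _ (nbhs xb) P _) H.
have : \forall x \near xb, [set w : 'rV[R]_m | `|w - 0| <= M] `<=` P x.
  apply: H => z _.
  have [U /nbhs_ballP[d /= d0 dU] HU] : exists2 U, nbhs (xb, z) U &
      forall x' z', U (x', z') -> P x' z'.
    have [Gz|nGz] := pselect (Gam xb z).
      have fz : f xb yb - e < f xb z.
        by apply: lt_le_trans (bmin z Gz); rewrite ltrBlDr ltrDl.
      have nf := near_continuous_gt (q0 := (xb, z)) (C1_continuous f1) fz.
      by eexists; [exact: nf | move=> x' z' /= Pxz _; exact: Pxz].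
    have pz : 0 < pen J (con ^~ xb) z.
      by rewrite ltNge; apply/negP => /Gamma_pen.
    have nf := near_continuous_gt (q0 := (xb, z)) con_pen_continuous pz.
    eexists; [exact: nf | move=> x' z' /= pz' /Gamma_pen].
    by rewrite leNgt pz'.
  exists (ball z d, ball xb d) => [/=|[z' x'] [/= zz' xx']].
    by split; exact: nbhsx_ballx.
  by apply: HU; apply: dU; split.
apply: filterS2 nV => x Vx Px z Gz; apply: Px => //=.
by rewrite subr0; apply: BM; exact: VB Gz.
Qed.

(** If no radius worked, points [xk] within [k.+1%:R^-1] of [xb] without a solution near [yb] would
    contradict the sequential definition. *)
Lemma inner_semicont_near (Omega : set 'rV[R]_n) xb yb (d : R) :
  inner_semicont_S p l f h Omega xb yb -> 0 < d ->
  exists2 a : R, 0 < a & forall x : 'rV[R]_n, `|x - xb| < a -> Omega x ->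
    exists2 s, S x s & `|s - yb| < d.
Proof.
move=> isc d0; apply: contrapT => nex.
have /choice[xk Hxk] : forall k : nat, exists x, [/\ `|x - xb| < k.+1%:R^-1, Omega x &
    forall s, S x s -> ~ `|s - yb| < d].
  move=> k; apply: contrapT => nx; apply: nex; exists k.+1%:R^-1; first by rewrite invr_gt0.
  move=> x xb_ Ox; apply: contrapT => ns; apply: nx; exists x; split=> // s Ss sd.
  by apply: ns; exists s.
have Ok k : Omega (xk k) by case: (Hxk k).
have xkb : xk @ \oo --> xb.
  apply/cvgrPdist_lt => e e0; near=> k.
  rewrite distrC; have [xkd _ _] := Hxk k; apply: lt_trans xkd _.
  by near: k; exact: near_infty_natSinv_lt (PosNum e0).
have [yk [ykb Sk]] := isc xk Ok xkb.
have /cvgrPdist_lt /(_ d d0) yd := ykb.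
have [k [Sxk ykd]] : exists k, S (xk k) (yk k) /\ `|yb - yk k| < d.
  by near \oo => k; exists k; split; near: k.
have [_ _ /(_ _ Sxk)] := Hxk k; by rewrite distrC.
Unshelve. all: by end_near.
Qed.

(** As [z] is a zero of the penalty, each violation shrinks by the factor [1 - t] towards [z];
    squaring is harmless because [(1 - t) ^+ 2 <= 1 - t]. *)
Lemma pen_convex x s z t : A1' p l f h -> S x s -> Gam x z -> f x z <= f x s ->
  0 <= t <= 1 -> forall w,
  pen J (residual f h x (f x s)) (t *: z + (1 - t) *: w) <=
  (1 - t) * pen J (residual f h x (f x s)) w.
Proof.
move=> cvx Ss Gz fz t01 w; have [cf [cI cJ]] := cvx x.
have /pen_residual_eq0/pen_eq0P[zI zJ] : Gam x z /\ f x z <= f x s by [].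
have /andP[t0 t1] := t01; have t1' : 0 <= 1 - t by rewrite subr_ge0.
have sq (a b : R) : 0 <= a -> a <= (1 - t) * b -> a ^+ 2 <= (1 - t) * b ^+ 2.
  move=> a0 ab; apply: le_trans (_ : ((1 - t) * b) ^+ 2 <= _).
    by rewrite ler_sqr ?nnegrE // (le_trans a0).
  by rewrite exprMn ler_wpM2r ?sqr_ge0 // expr2 ler_piMl //; lra.
rewrite /pen mulr_sumr; apply: ler_sum => i _.
set g := residual f h x (f x s) in zI zJ *.
have [iJ|iJ] := boolP (i \in J).
  rewrite /viol.
  have -> : g i (t *: z + (1 - t) *: w) = (1 - t) * g i w.
    have := zJ i iJ; rewrite /g !residual_con ?(Jset_neq0 iJ) // cJ // => ->.
    by rewrite mulr0 add0r.
  by rewrite exprMn ler_wpM2r ?sqr_ge0 // expr2 ler_piMl //; lra.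
apply: sq; first exact: viol_ge0.
have gle : g i (t *: z + (1 - t) *: w) <= (1 - t) * g i w.
  apply: le_trans (_ : t * g i z + (1 - t) * g i w <= _); last first.
    by rewrite gerDr mulr_ge0_le0 // zI.
  have [->|i0] := eqVneq i ord0.
    by rewrite /g !residual_obj; have := cf z w t t01; lra.
  rewrite /g !residual_con //; apply: cI => //; exact: notin_Jset.
rewrite /viol ge_max; apply/andP; split; last first.
  by rewrite mulr_ge0 // le_max lexx orbT.
by apply: le_trans gle _; rewrite ler_wpM2l // le_max lexx.
Qed.

End ErrorBound.

(** * The error bound in both cases, and partial calmness *)

Section PartialCalmness.
Variables (R : realType) (n m p l : nat).
Variables (f : 'rV[R]_n -> 'rV[R]_m -> R) (h : nat -> 'rV[R]_n -> 'rV[R]_m -> R).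
Hypotheses (f1 : C1 f) (h1 : forall i : nat, (1 <= i <= p)%N -> C1 (h i)).
Hypothesis lp : (l <= p)%N.
Local Notation J := (Jset p l).
Local Notation Gam := (Gamma p l h).
Local Notation S := (Ssol p l f h).
Local Notation Om := (domGamma p l h).

(** The solution [s] supplies the value of [phi] as a real number, while [z] is the solution close
    to [y]; [kappa] is independent of [eta]. *)
Definition feasible_error_bound (xb : 'rV[R]_n) (yb : 'rV[R]_m) (kappa : R) :=
  forall eta : R, 0 < eta -> exists2 d : R, 0 < d &
    forall (x : 'rV[R]_n) (y : 'rV[R]_m),
    `|x - xb| < d -> `|y - yb| < d -> Gam x y ->
    exists s z, [/\ S x s, S x z, `|z - y| <= eta & `|z - y| <= kappa * (f x y - f x s)].

Lemma feasible_domGamma x y : Gam x y -> Om x.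
Proof. by move=> Gy; apply/eqP => G0; have : set0 y by rewrite -G0. Qed.

(** A solution [s] near [y] is an admissible competitor with zero penalty, so [N] times the penalty
    at [w] is at most the squared distance from [s] to [y], whatever [N] is. *)
Lemma error_bound_inner_semicont xb yb : S xb yb ->
  inner_semicont_S p l f h Om xb yb -> RCPLD_S p l f h Om xb yb ->
  exists2 kappa : R, 0 < kappa & feasible_error_bound xb yb kappa.
Proof.
move=> Sb isc rc; have Gb := proj1 Sb.
have [kappa [e0 [kappa0 e00 est]]] :=
  penalized_estimate f1 h1 lp (feasible_domGamma Gb) Gb rc.
exists kappa => // eta eta0.
have [e [ep ee0 eeta]] : exists e : R, [/\ 0 < e, e <= e0 & e <= eta].
  by exists (Num.min e0 eta); rewrite lt_min e00 !ge_min !lexx orbT.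
have ee : 0 < e <= e0 by rewrite ep.
(* The distances from [s] to [yb] and from [yb] to [y] add up to the threshold of [dot_small]. *)
pose d := e / (2 * m.+1%:R) / 2.
have m1 : 1 <= m.+1%:R :> R by rewrite ler1n.
have m0 : 0 < m.+1%:R :> R by rewrite ltr0n.
have d0 : 0 < d by rewrite !divr_gt0 // mulr_gt0.
have dd : d + d = e / (2 * m.+1%:R) by rewrite /d -splitr.
have de : d + d <= e.
  by rewrite dd ler_pdivrMr ?mulr_gt0 // ler_peMr ?ltW //; lra.
have [a a0 near_s] := inner_semicont_near isc d0.
exists (Num.min e (Num.min a d)); first by rewrite !lt_min ep a0.
move=> x y; rewrite !lt_min => /and3P[xe xa _] /and3P[ye _ yd] Gy.
have Ox := feasible_domGamma Gy.
have [s Ss sd] := near_s x xa Ox.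
have sy : `|s - y| <= d + d.
  have -> : s - y = (s - yb) - (y - yb) by rewrite opprB addrA subrK.
  by apply: le_trans (ler_normB _ _) _; rewrite lerD // ltW.
have fsy : f x s <= f x y by case: Ss => _; exact.
have e2 : 0 < e ^+ 2 by rewrite exprn_gt0.
have rho : 0 < e ^+ 2 / 2 < e ^+ 2 by apply/andP; split; lra.
have [z [Sz ze zK]] : exists z : 'rV[R]_m, [/\ S x z, `|z - y| <= e &
    `|z - y| <= kappa * (f x y - f x s)].
  have K0 : 0 <= kappa * (f x y - f x s) by rewrite mulr_ge0 ?subr_ge0 // ltW.
  apply: (solution_of_penalized f1 h1 Ss (ltW ep) K0
    (D := dot (s - y) (s - y))) => N N0.
   have [w [we wK wmin]] := est e ee x y _ _ N xe ye Ox Gy fsy N0 rho.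
  exists w; split => //.
  have sle : dot (s - y) (s - y) <= e ^+ 2 / 2.
    by apply/ltW/dot_small; rewrite // -dd.
  have := wmin s (le_trans sy de) sle.
  have ps : pen J (residual f h x (f x s)) s = 0.
    apply/eqP; rewrite eq_le pen_ge0 andbT.
    by apply/pen_residual_eq0; case: Ss.
  rewrite ps mulr0 addr0; have := dot_ge0 (w - y); lra.
by exists s, z; split => //; exact: le_trans ze eeta.
Qed.

(** A solution [s] exists but may lie outside the ball, so the competitor is a point [wt] of the
    segment from [w] to [s]; convexity gives the same bound on [N] times the penalty. *)
Lemma error_bound_convex xb yb : S xb yb ->
  A1' p l f h -> loc_bounded_Gamma p l h xb -> RCPLD_S p l f h Om xb yb ->
  exists2 kappa : R, 0 < kappa & feasible_error_bound xb yb kappa.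
Proof.
move=> Sb cvx lb rc; have Gb := proj1 Sb.
have [kappa [e0 [kappa0 e00 est]]] :=
  penalized_estimate f1 h1 lp (feasible_domGamma Gb) Gb rc.
exists kappa => // eta eta0.
have [e [ep ee0 eeta]] : exists e : R, [/\ 0 < e, e <= e0 & e <= eta].
  by exists (Num.min e0 eta); rewrite lt_min e00 !ge_min !lexx orbT.
have ee : 0 < e <= e0 by rewrite ep.
have m0 : 0 < m.+1%:R :> R by rewrite ltr0n.
(* The gap [f x y - f x s] will be below [d + d]: one [d] from continuity of [f], one from
   [value_lsc]. Times [kappa], this is the threshold of [dot_small]. *)
pose d := e / (2 * m.+1%:R) / 2 / kappa.
have d0 : 0 < d by rewrite !divr_gt0 // mulr_gt0.
have dd : kappa * (d + d) = e / (2 * m.+1%:R).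
  by rewrite /d; field; rewrite !gt_eqF.
have /nbhs_ballP[a1 /= a10 lsc] := value_lsc f1 h1 Sb lb d0.
have [B [M [BM [V [/nbhs_ballP[a2 /= a20 dV] VB]]]]] := lb.
have fc : \forall q \near (xb, yb), f q.1 q.2 < f xb yb + d.
  by apply: near_continuous_lt; [exact: C1_continuous | rewrite ltrDl].
have /nbhs_ballP[a3 /= a30 fub] := fc.
exists (Num.min e (Num.min a1 (Num.min a2 a3))); first by rewrite !lt_min ep a10 a20.
move=> x y; rewrite !lt_min => /and4P[xe xa1 xa2 xa3] /and4P[ye _ _ ya3] Gy.
have Ox := feasible_domGamma Gy.
have GM z : Gam x z -> `|z| <= M.
  move=> Gz; apply: BM; apply: VB Gz; apply: dV.
  by rewrite -ball_normE /= distrC.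
have [s Ss] : exists s, S x s.
  by apply: (Ssol_nonempty f1 h1 (M := M)) => //; exists y.
have [Gs smin] := Ss.
have fsy : f x s <= f x y := smin y Gy.
have Hd : f x y - f x s < d + d.
  have hs : f xb yb - d < f x s by apply: lsc Gs; rewrite -ball_normE /= distrC.
  have hy : f x y < f xb yb + d.
    by apply: (fub (x, y)); split; rewrite -ball_normE /= distrC.
  lra.
have e2 : 0 < e ^+ 2 by rewrite exprn_gt0.
have rho : 0 < e ^+ 2 / 2 < e ^+ 2 by apply/andP; split; lra.
have [z [Sz ze zK]] : exists z : 'rV[R]_m, [/\ S x z, `|z - y| <= e &
    `|z - y| <= kappa * (f x y - f x s)].
  have K0 : 0 <= kappa * (f x y - f x s) by rewrite mulr_ge0 ?subr_ge0 // ltW.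
  apply: (solution_of_penalized f1 h1 Ss (ltW ep) K0
    (D := dot (s - y) (s - y))) => N N0.
   have [w [we wK wmin]] := est e ee x y _ _ N xe ye Ox Gy fsy N0 rho.
  exists w; split => //.
  have wrho : dot (w - y) (w - y) < e ^+ 2 / 2.
    by apply: dot_small => //; rewrite -dd (le_trans wK) // ler_pM2l // ltW.
  pose sw := dot (w - y) (w - y); pose ss := dot (s - y) (s - y).
  have sw0 : 0 <= sw := dot_ge0 _.
  have ss0 : 0 <= ss := dot_ge0 _.
  (* [w] lies strictly inside the ball, so it can be compared with a point of
     the segment from [w] to [s] close to [w]. *)
  pose t := Num.min 1 ((e ^+ 2 / 2 - sw) / (ss + 1)).
  have t0 : 0 < t by rewrite lt_min ltr01 divr_gt0 ?subr_gt0 // ltr_wpDl.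
  have t1 : t <= 1 by rewrite ge_min lexx.
  have tss : t * (ss + 1) <= e ^+ 2 / 2 - sw.
    by rewrite -ler_pdivlMr ?ltr_wpDl // ge_min lexx orbT.
  have t01 : 0 <= t <= 1 by rewrite ltW.
  set wt := t *: s + (1 - t) *: w.
  have wty : dot (wt - y) (wt - y) <= (1 - t) * sw + t * ss.
    have -> : wt - y = t *: (s - y) + (1 - t) *: (w - y).
      by apply/rowP => j; rewrite /wt !mxE; ring.
    (* The defect in the convexity inequality for the squared distance is [t * (1 - t)] times the
       squared distance from [s] to [w]. *)
    have := mulr_ge0 (mulr_ge0 (ltW t0) (_ : 0 <= 1 - t)) (dot_ge0 ((s - y) - (w - y))).
    rewrite subr_ge0 => /(_ t1).
    rewrite /sw /ss; move: (s - y) (w - y) => u v.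
    rewrite dotBl !dotBr !dotDl !dotDr !dotZl !dotZr (dotC v u) => Huv.
    rewrite -subr_ge0; apply: le_trans Huv _.
    by rewrite le_eqVlt; apply/orP; left; apply/eqP; ring.
  have wtrho : dot (wt - y) (wt - y) <= e ^+ 2 / 2.
    apply: le_trans wty _; move: tss; rewrite mulrDr mulr1 mulrBl mul1r.
    have := mulr_ge0 (ltW t0) sw0; lra.
  have wte : `|wt - y| <= e.
    have epw := ltW ep.
    rewrite -ler_sqr ?nnegrE //; apply: le_trans (norm_sqr_le_dot _) _.
    by apply: le_trans wtrho _; lra.
  have := wmin wt wte wtrho.
  have pwt := pen_convex cvx Ss Gs (lexx _) t01 w.
  rewrite -/sw -/wt in pwt *.
  move: (pen J _ w) (pen J _ wt) pwt => P Pt /(ler_wpM2l (ltW N0)) pwt wmin'.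
  (* Comparison with [wt] yields the bound multiplied by [t], which is positive. *)
  rewrite -(ler_pM2l t0) -/ss.
  move: pwt wty; rewrite mulrCA mulrBl mul1r [(1 - t) * sw]mulrBl mul1r => pwt wty.
  have := mulr_ge0 (ltW t0) sw0; lra.
by exists s, z; split => //; exact: le_trans ze eeta.
Qed.

(** The nearby solution [z] competes in the local minimality of [(xb, yb)]; passing from [z] to [y]
    costs [F] at most [L] times their distance, hence at most [L * kappa * u]. *)
Lemma error_bound_partially_calm (F : 'rV[R]_n -> 'rV[R]_m -> R)
  (X : set 'rV[R]_n) xb yb (kappa : R) : C1 F -> 0 < kappa ->
  feasible_error_bound xb yb kappa ->
  local_min_BPP p l f h F X xb yb -> partially_calm p l f h F X xb yb.
Proof.
move=> F1 kappa0 eb [Xb [Sb [V [/nbhs_ballP[d1 /= d10 dV] Vmin]]]].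
have [d2 d20 strict] := C1_strict xb yb F1 ltr01.
have [L L0 gL] : exists2 L : R, 0 <= L &
    forall v : 'rV[R]_m, `|dot (grad_y F xb yb) v| + `|v| <= L * `|v|.
  exists (m%:R * `|grad_y F xb yb| + 1) => [|v]; first by rewrite addr_ge0 // mulr_ge0.
  by rewrite mulrDl mul1r lerD2r -mulrA norm_dot.
have LF (x : 'rV[R]_n) (y z : 'rV[R]_m) : `|x - xb| < d2 -> `|y - yb| < d2 ->
    `|z - yb| < d2 -> - (L * `|y - z|) <= F x y - F x z.
  move=> xd yd zd; have := strict x y z xd yd zd; have := gL (y - z).
  move: (dot _ _) (L * _) => D c Dc; rewrite mul1r ler_norml => /andP[sl _].
  have := ler_norm (- D); rewrite normrN; lra.
(* Half, so that [z] stays within both radii of [yb]. *)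
pose eta := Num.min d1 d2 / 2.
have eta0 : 0 < eta by rewrite divr_gt0 // lt_min d10.
have etaE : eta + eta = Num.min d1 d2 by rewrite -splitr.
have [d3 d30 ebd] := eb eta eta0.
pose r := Num.min eta d3.
have r0 : 0 < r by rewrite lt_min eta0.
have eta12 : eta < d1 /\ eta < d2.
  have : eta < Num.min d1 d2 by rewrite -etaE ltrDl.
  by rewrite lt_min => /andP.
exists (ball ((xb, yb), 0 : R) r), (L * kappa + 1); split; first exact: nbhsx_ballx.
split; first by rewrite ltr_wpDl // mulr_ge0 // ltW.
move=> x y u [[/= bx by_] _] Xx phu Gy.
have {}bx : `|x - xb| < r by move: bx; rewrite -ball_normE /= distrC.
have {}by_ : `|y - yb| < r by move: by_; rewrite -ball_normE /= distrC.
move: bx by_; rewrite !lt_min => /andP[xeta xd3] /andP[yeta yd3].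
have [s [z [Ss Sz zeta zK]]] := ebd x y xd3 yd3 Gy.
have zyb : `|z - yb| < Num.min d1 d2.
  have -> : z - yb = (z - y) + (y - yb) by rewrite addrA subrK.
  by rewrite (le_lt_trans (ler_normD _ _)) // -etaE ler_ltD.
move: zyb; rewrite lt_min => /andP[zd1 zd2].
have [ed1 ed2] := eta12.
have Fz : F xb yb <= F x z.
  apply: Vmin Xx Sz; apply: dV.
  by split; rewrite -ball_normE /= distrC // (lt_trans xeta).
have Fy := LF x y z (lt_trans xeta ed2) (lt_trans yeta ed2) zd2.
have Hu : f x y - f x s <= u.
  by move: phu; rewrite (Ssol_phi Ss) -EFinB lee_fin.
have H0 : 0 <= f x y - f x s by rewrite subr_ge0; case: Ss => _; exact.
have u0 : 0 <= u := le_trans H0 Hu.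
rewrite ger0_norm //.
have h3 : L * `|y - z| <= L * kappa * u.
  rewrite -mulrA ler_wpM2l // distrC (le_trans zK) // ler_pM2l //.
rewrite mulrDl mul1r; move: Fy Fz h3 u0.
move: (L * _) (L * _ * _) (F x y) (F x z) (F xb yb) => a b c d' e'; lra.
Qed.

End PartialCalmness.

Theorem theorem4p19 (R : realType) (n m p l : nat)
  (F f : 'rV[R]_n -> 'rV[R]_m -> R) (h : nat -> 'rV[R]_n -> 'rV[R]_m -> R)
  (X : set 'rV[R]_n) (xb : 'rV[R]_n) (yb : 'rV[R]_m) :
  (l <= p)%N ->
  C1 F -> C1 f -> (forall i : nat, (1 <= i <= p)%N -> C1 (h i)) ->
  closed X ->
  local_min_BPP p l f h F X xb yb ->
  ((A1' p l f h /\ loc_bounded_Gamma p l h xb /\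
    (forall y, Ssol p l f h xb y -> RCPLD_S p l f h (domGamma p l h) xb y))
   \/
   (inner_semicont_S p l f h (domGamma p l h) xb yb /\
    RCPLD_S p l f h (domGamma p l h) xb yb)) ->
  partially_calm p l f h F X xb yb.
Proof.
move=> lp F1 f1 h1 _ bmin hyp; have [_ [Sb _]] := bmin.
have [kappa kappa0 eb] : exists2 kappa : R, 0 < kappa &
    feasible_error_bound p l f h xb yb kappa.
  case: hyp => [[cvx [lb rc]]|[isc rc]].
    exact: error_bound_convex (rc _ Sb).
  exact: error_bound_inner_semicont.
exact: error_bound_partially_calm eb bmin.
Qed.
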